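(* There exists a drop $\gamma:[0,1]\to\mathbb{R}^2$ such that $F(\gamma)=m$, where $m:=\inf\{F(\gamma)\mid\gamma\text{ is a drop}\}$.
   Context: A drop is a regular curve $\gamma:[0,1]\to\mathbb{R}^2$ of class $H^2$ such that $\gamma(0)=\gamma(1)$ (no condition is imposed on the tangents at $x=0$ and $x=1$); regular means $|\partial_x\gamma|\neq0$ on $[0,1]$. For a regular curve $\gamma$ of class $H^2$ with scalar curvature $k$ and arclength $s$, $F(\gamma)=\int_\gamma(k^2+1)\,\mathrm{d}s$. *)

(* Defs.v *)
From HB Require Import structures.
From mathcomp Require Import all_boot all_order all_algebra.
From mathcomp Require Import all_classical all_reals all_analysis.

Set Implicit Arguments.
Unset Strict Implicit.
Unset Printing Implicit Defensive.

Import Order.TTheory GRing.Theory Num.Theory.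
Import numFieldNormedType.Exports.
Local Open Scope classical_set_scope.
Local Open Scope ring_scope.

(* A function on [0, 1] is represented by a function on R of which only the
   restriction to `[0, 1] matters. *)

Definition L2 (R : realType) (u : R -> R) : Prop :=
  (u \_ `[0, 1]) \in Lfun (@lebesgue_measure R) 2%:E.

(* Smooth functions with compact support in the open interval ]0, 1[. *)
Definition test_function (R : realType) (phi : R -> R) : Prop :=
  (forall n x, derivable (derive1n n phi) x 1) /\
  closure [set x | phi x != 0] `<=` `]0, 1[.

Definition is_weak_derivative (R : realType) (n : nat) (u v : R -> R) : Prop :=
  forall phi, test_function phi ->
    \int[lebesgue_measure]_(x in `[0, 1]) (u x * derive1n n phi x) =
    (-1) ^+ n * \int[lebesgue_measure]_(x in `[0, 1]) (v x * phi x).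

(* The Sobolev space H^m(0, 1) = W^{m,2}(0, 1), without identifying functions
   which agree almost everywhere. *)
Definition sobolev (R : realType) (m : nat) (u : R -> R) : Prop :=
  L2 u /\
  forall n, (n <= m)%N -> exists v, L2 v /\ is_weak_derivative n u v.

(* For n <= m and u in H^m(0, 1), a representative of the (a.e. unique) weak
   n-th derivative of u. *)
Definition weak_derivative (R : realType) (n : nat) (u : R -> R) : R -> R :=
  get [set v | L2 v /\ is_weak_derivative n u v].

(* Classical derivative on [0, 1], one-sided at the endpoints; it exists when u
   is the continuous representative of an element of H^2(0, 1). *)
Definition derivative01 (R : realType) (u : R -> R) (x : R) : R :=
  lim ((u y - u x) / (y - x) @[y --> within `[0, 1] x^']).

(* Elements of H^2(0, 1) are identified with their continuous representatives,
   hence the first clause. *)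
Definition H2_curve (R : realType) (gamma : R -> R * R) : Prop :=
  [/\ {within `[0, 1], continuous gamma},
      sobolev 2 (fst \o gamma) & sobolev 2 (snd \o gamma)].

(* The Euclidean norm of the derivative (the library norm on R * R is the
   sup norm). *)
Definition speed (R : realType) (gamma : R -> R * R) (x : R) : R :=
  Num.sqrt (derivative01 (fst \o gamma) x ^+ 2 +
            derivative01 (snd \o gamma) x ^+ 2).

Definition regular_curve (R : realType) (gamma : R -> R * R) : Prop :=
  forall x, x \in `[0, 1] -> speed gamma x != 0.

(* k = det (gamma', gamma'') / |gamma'|^3, defined almost everywhere. *)
Definition curvature (R : realType) (gamma : R -> R * R) (x : R) : R :=
  (derivative01 (fst \o gamma) x * weak_derivative 2 (snd \o gamma) x -
   derivative01 (snd \o gamma) x * weak_derivative 2 (fst \o gamma) x) /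
  speed gamma x ^+ 3.

Definition drop_curve (R : realType) : set (R -> R * R) :=
  [set gamma | [/\ H2_curve gamma, regular_curve gamma & gamma 0 = gamma 1]].

(* ds = |gamma'| dx. *)
Definition elastic_energy (R : realType) (gamma : R -> R * R) : \bar R :=
  (\int[lebesgue_measure]_(x in `[0%R, 1%R])
     ((curvature gamma x ^+ 2 + 1) * speed gamma x)%R%:E)%E.

(* Main.v *)
(* Write F = int (th'^2 + 1) ds with th the tangent angle. Since gamma is closed,
   int cos (th - m) ds = 0 for every m, so multiples of this integral may be
   added to F. Choose m such that th - m ranges over [-b, b]; closedness forces
   b > pi/2. With mu = -1 / cos (min b pi), AM-GM gives
     F = int (th'^2 + 1 + mu cos (th - m)) ds
       >= 2 int |th'| sqrt (1 + mu cos (th - m)) ds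
       >= 2 int_(-b)^b sqrt (1 + mu cos r) dr.
   The substitution sin (r/2) = sqrt x sin phi, x = sin^2 (b/2), turns the last
   integral into c(x) int x cos^2 phi / sqrt (1 - x sin^2 phi) dphi, a convex
   function of x times (2x - 1)^(-1/2). Its minimum is at the root y of
   2 E(y) = K(y), found by the intermediate value theorem; there the pendulum
   trajectory is itself a closed curve (half of the figure-eight elastica), which
   attains the bound. *)
Require Import Defs.
From mathcomp Require Import all_boot all_order all_algebra.
From mathcomp Require Import all_classical all_reals all_analysis.
From mathcomp Require Import measurable_realfun.
From mathcomp Require Import ring lra.

Set Implicit Arguments.
Unset Strict Implicit.
Unset Printing Implicit Defensive.

Import Order.TTheory GRing.Theory Num.Theory.
Import numFieldNormedType.Exports.
Local Open Scope classical_set_scope.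
Local Open Scope ring_scope.

(** * Absolutely continuous functions *)

(** The multiplier [mu] makes [1 + mu cos r] vanish exactly at the ends of the truncated range of
    angles. Equality in AM-GM then reads [th' = v sqrt (1 + mu cos (th - m))], with [v] the speed:
    the energy equation of a pendulum with turning points at these ends. This also explains why the
    best pendulum trajectory is closed: the derivative of the bound in [mu] is the integral of
    [cos r / sqrt (1 + mu cos r)], that is, of [cos (th - m) ds] along the trajectory, and the
    moving ends contribute nothing because the root vanishes there. Criticality of the bound and
    closedness of the trajectory are thus one and the same equation, [2 E = K].

    The obstacle is regularity. A drop is only of class H^2, so its tangent angle is merely
    absolutely continuous, and its weak second derivative is a choice among functions equal almost
    everywhere. The calculus is therefore done with integrals of densities, and a du Bois-Reymond
    lemma turns weak derivatives into such densities. *)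

Section segment_integral.
Context {R : realType}.
Implicit Types (f g h : R -> R) (a b c : R).
Notation mu := (@lebesgue_measure R).

Definition segint g a b : R := \int[mu]_(t in `[a, b]) g t.

Definition segintegrable g a b := mu.-integrable `[a, b] (EFin \o g).

Lemma segintegrable_sub g a b a' b' : a <= a' -> b' <= b ->
  segintegrable g a b -> segintegrable g a' b'.
Proof.
move=> aa bb; apply: integrableS => //; apply: subset_itv; by rewrite bnd_simp.
Qed.

Lemma segint_xx g a : segint g a a = 0.
Proof. by rewrite /segint set_itv1 Rintegral_set1. Qed.

Lemma segint_add g a b c : a <= b -> b <= c -> segintegrable g a c ->
  segint g a c = segint g a b + segint g b c.
Proof.
move=> ab bc ig.
have := @Rintegral_itvB R g (BLeft a) (BRight c) b ig.
rewrite !bnd_simp => /(_ ab bc) eq; rewrite /segint -[LHS](subrK (segint g a b)) addrC.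
rewrite {2}/segint eq Rintegral_itv_obnd_cbnd//.
by apply: integrableS ig => //; apply: subset_itvr; rewrite bnd_simp.
Qed.

Lemma segintegrableD f g a b : segintegrable f a b -> segintegrable g a b ->
  segintegrable (fun x => f x + g x) a b.
Proof. by move=> fi gi; apply: (integrableD _ fi gi). Qed.

Lemma segintegrableB f g a b : segintegrable f a b -> segintegrable g a b ->
  segintegrable (fun x => f x - g x) a b.
Proof. by move=> fi gi; apply: (integrableB _ fi gi). Qed.

Lemma segintegrableZ k g a b : segintegrable g a b ->
  segintegrable (fun x => k * g x) a b.
Proof. by move=> gi; apply: (integrableZl _ _ gi). Qed.

Lemma segintegrable_norm g a b : segintegrable g a b ->
  segintegrable (fun x => `|g x|) a b.
Proof. by move=> gi; apply: (integrable_abse gi). Qed.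

Lemma segintegrable_within g a b : {within `[a, b], continuous g} ->
  segintegrable g a b.
Proof.
by move=> cg; apply: continuous_compact_integrable => //; exact: segment_compact.
Qed.

Lemma segintegrable_cont g a b : continuous g -> segintegrable g a b.
Proof. by move=> cg; apply: segintegrable_within; exact: continuous_subspaceT. Qed.

Lemma segintegrableM g h a b : {within `[a, b], continuous h} ->
  segintegrable g a b -> segintegrable (fun x => g x * h x) a b.
Proof.
move=> ch ig; apply: (@integrableMl _ _ _ mu _ _ (EFin \o g) h) => //.
  by apply: subspace_continuous_measurable_fun.
have /compact_bounded[M [_ mrt]] := continuous_compact ch (@segment_compact _ a b).
by exists M; split; rewrite ?num_real // => ? ? ? ?; exact: mrt.
Qed.

Lemma segintD f g a b : segintegrable f a b -> segintegrable g a b ->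
  segint (fun x => f x + g x) a b = segint f a b + segint g a b.
Proof. by move=> *; apply: RintegralD. Qed.

Lemma segintB f g a b : segintegrable f a b -> segintegrable g a b ->
  segint (fun x => f x - g x) a b = segint f a b - segint g a b.
Proof. by move=> *; apply: RintegralB. Qed.

Lemma segintZ k g a b : segintegrable g a b ->
  segint (fun x => k * g x) a b = k * segint g a b.
Proof. by move=> *; apply: RintegralZl. Qed.

Lemma eq_segint f g a b : (forall x, a <= x <= b -> f x = g x) ->
  segint f a b = segint g a b.
Proof.
by move=> fg; apply: eq_Rintegral => x; rewrite inE/= in_itv/= => /fg.
Qed.

Lemma segint_oo f a b : segintegrable f a b ->
  segint f a b = \int[mu]_(t in `]a, b[) f t.
Proof.
move=> fi; rewrite /segint -Rintegral_itv_bndo_bndc; last first.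
  by apply: integrableS fi => //; apply: subset_itvl; rewrite bnd_simp.
rewrite Rintegral_itv_obnd_cbnd//.
by apply: integrableS fi => //; apply: subset_itv; rewrite bnd_simp.
Qed.

Lemma eq_segint_oo f g a b : segintegrable f a b -> segintegrable g a b ->
  (forall x, a < x < b -> f x = g x) -> segint f a b = segint g a b.
Proof.
move=> fi gi fg; rewrite !segint_oo//; apply: eq_Rintegral => x.
by rewrite inE/= in_itv/= => /fg.
Qed.

Lemma eq_segintegrable f g a b : (forall x, a <= x <= b -> f x = g x) ->
  segintegrable f a b -> segintegrable g a b.
Proof.
move=> fg; apply: eq_integrable => // x; rewrite inE/= in_itv/= => /fg ->//.
Qed.

Lemma le_segint f g a b : segintegrable f a b -> segintegrable g a b ->
  (forall x, a <= x <= b -> f x <= g x) -> segint f a b <= segint g a b.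
Proof. by move=> ? ? fg; apply: le_Rintegral => //= x; rewrite in_itv/= => /fg. Qed.

Lemma segint_ge0 g a b : (forall x, a <= x <= b -> 0 <= g x) ->
  0 <= segint g a b.
Proof. by move=> fg; apply: Rintegral_ge0 => //= x; rewrite in_itv/= => /fg. Qed.

Lemma le_norm_segint g a b : segintegrable g a b ->
  `|segint g a b| <= segint (fun x => `|g x|) a b.
Proof. by move=> *; apply: le_normr_Rintegral. Qed.

Lemma segint_cst k a b : a <= b -> segint (fun=> k) a b = k * (b - a).
Proof.
rewrite le_eqVlt => /predU1P[<-|ab]; first by rewrite segint_xx subrr mulr0.
by rewrite /segint Rintegral_cst//= lebesgue_measure_itv/= lte_fin ab -EFinD.
Qed.

(* Cousin's lemma for relations which are additive on consecutive segments. *)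
Lemma segment_ind (P : R -> R -> Prop) :
  (forall a b c, a <= b -> b <= c -> P a b -> P b c -> P a c) ->
  (forall z, exists2 d : R, 0 < d &
     forall a b, a <= z -> z <= b -> z - d < a -> b < z + d -> P a b) ->
  forall x y, x <= y -> P x y.
Proof.
move=> Padd Ploc x y xy.
pose S := [set t | x <= t <= y /\ P x t].
have Sx : S x.
  split; first by rewrite lexx xy.
  by have [d d0] := Ploc x; apply => //; lra.
have ubS : ubound S y by move=> t [/andP[]].
have supS : has_sup S by split; [exists x | exists y].
set s := sup S.
have xs : x <= s by exact: ub_le_sup supS.2 _ Sx.
have sy : s <= y by apply: ge_sup => //; exists x.
have [d d0 Pd] := Ploc s.
have [t [/andP[xt ty] Pt] st] := @sup_adherent _ S d d0 supS.
have ts : t <= s by apply: (ub_le_sup supS.2); split=> //; apply/andP.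
have [ys|sy'] := leP y (s + d / 2).
  by apply: (Padd _ t) => //; apply: Pd => //; lra.
have : S (s + d / 2).
  split; first by apply/andP; split; lra.
  by apply: (Padd _ t) => //; [lra|apply: Pd => //; lra].
by move=> /(ub_le_sup supS.2); rewrite -/s; lra.
Qed.

End segment_integral.

(** * Chain and product rules for integrals of locally integrable densities *)

Section absolute_continuity.
Context {R : realType}.
Implicit Types (u v w F f g h : R -> R) (x y : R).

(** Absolute continuity through a chosen density. It is required on the whole line, so that
    continuity needs no subspace topology; data on [0, 1] are extended beforehand. *)
Definition ac u g := forall x y, x <= y ->
  segintegrable g x y /\ u y - u x = segint g x y.

Lemma ac_continuous u g : ac u g -> continuous u.
Proof.
move=> ug z.
have : {within `[z - 1, z + 1], continuous
    (fun x => u (z - 1) + parameterized_integral lebesgue_measure (z - 1) x g)}.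
  move=> t; apply: cvgD; first exact: cvg_cst.
  by apply: parameterized_integral_continuous; [|apply: (ug _ _ _).1]; lra.
move=> cu.
have cu' : {within `[z - 1, z + 1], continuous u}.
  apply: subspace_eq_continuous cu => t; rewrite inE/= in_itv/= => /andP[zt _].
  have := (ug _ _ zt).2; rewrite /from_subspace /parameterized_integral.
  by rewrite /segint => <-; rewrite addrC subrK.
have zz : z - 1 < z + 1 by lra.
have /(continuous_within_itvP _ zz)[+ _ _] := cu'.
by apply; rewrite in_itv/=; lra.
Qed.

Lemma ac_cst k : ac (fun=> k) (fun=> 0).
Proof.
move=> x y xy; split; first by apply: segintegrable_cont; exact: cst_continuous.
by rewrite segint_cst// subrr mul0r.
Qed.

Lemma acD u v f g : ac u f -> ac v g ->
  ac (fun x => u x + v x) (fun x => f x + g x).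
Proof.
move=> uf vg x y xy; have [iF uF] := uf _ _ xy; have [ig vG] := vg _ _ xy.
split; first exact: segintegrableD.
by rewrite segintD// -uF -vG; ring.
Qed.

Lemma acB u v f g : ac u f -> ac v g ->
  ac (fun x => u x - v x) (fun x => f x - g x).
Proof.
move=> uf vg x y xy; have [iF uF] := uf _ _ xy; have [ig vG] := vg _ _ xy.
split; first exact: segintegrableB.
by rewrite segintB// -uF -vG; ring.
Qed.

Lemma acZ k u f : ac u f -> ac (fun x => k * u x) (fun x => k * f x).
Proof.
move=> uf x y xy; have [iF uF] := uf _ _ xy.
split; first exact: segintegrableZ.
by rewrite segintZ// -uF; ring.
Qed.

Lemma ac_eq u f g : (forall x, f x = g x) -> ac u f -> ac u g.
Proof. by move=> fg; have -> : f = g by apply/funext. Qed.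

(* On a short segment the mean value theorem gives F (u b) - F (u a) as
   h (u e) times the integral of g for some e in the segment. *)
Lemma ac_comp F h u g : ac u g -> continuous h ->
  (forall x, is_derive x 1 F (h x)) ->
  ac (F \o u) (fun x => g x * h (u x)).
Proof.
move=> ug ch dF.
have cu := ac_continuous ug.
have chu : continuous (fun x => h (u x)).
  by move=> x; apply: continuous_comp; [exact: cu|exact: ch].
have ighu x y : x <= y -> segintegrable (fun x => g x * h (u x)) x y.
  move=> xy; apply: segintegrableM; last exact: (ug _ _ xy).1.
  exact: continuous_subspaceT.
have cF : continuous F.
  by move=> x; apply: differentiable_continuous; apply/derivable1_diffP; have [] := dF x.
move=> x y xy; split; first exact: ighu.
(* The error estimate adds up over consecutive segments, so it suffices to prove it locally; letting
   [e] tend to 0 then gives the equality. *)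
suff key : forall e, 0 < e -> forall a b, a <= b ->
    `|F (u b) - F (u a) - segint (fun x => g x * h (u x)) a b|
      <= e * segint (fun x => `|g x|) a b.
  apply/eqP; rewrite -subr_eq0 -normr_le0; apply/ler_addgt0Pl => e e0.
  rewrite addr0.
  set N := segint (fun x => `|g x|) x y.
  have N0 : 0 <= N by apply: segint_ge0.
  have N1 : 0 < N + 1 by lra.
  have := key (e / (N + 1)) (divr_gt0 e0 N1) x y xy.
  move/le_trans; apply; rewrite -/N -mulrA ler_piMr// ?(ltW e0)//.
  by rewrite mulrC ler_pdivrMr// mul1r; lra.
move=> e e0; apply: segment_ind => [a b c ab bc Pa Pb|z].
  have ac := le_trans ab bc.
  rewrite (segint_add ab bc (ighu _ _ ac)).
  rewrite (segint_add ab bc (segintegrable_norm (ug _ _ ac).1)) mulrDr.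
  apply: le_trans (lerD Pa Pb); apply: le_trans (ler_normD _ _).
  by rewrite le_eqVlt; apply/orP; left; apply/eqP; congr `|_|; ring.
have /cvgrPdist_lt/(_ (e / 2))[|d /= d0 hd] := chu z; first by rewrite divr_gt0.
exists d => // a b az zb ad bd.
have ab := le_trans az zb.
have hz t : a <= t <= b -> `|h (u z) - h (u t)| < e / 2.
  move=> /andP[at_ tb]; apply: hd; rewrite /ball_/= ltr_norml; apply/andP; split; lra.
have [r rab Fr] : exists2 r, a <= r <= b & F (u b) - F (u a) = h (u r) * (u b - u a).
  have [uab|uba] := leP (u a) (u b).
  - have [|c cab Fc] := @MVT_segment R F h _ _ uab (fun x _ => dF x).
      exact: continuous_subspaceT.
    have [||r rab rc] := @IVT R u a b c ab; first exact: continuous_subspaceT.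
      by rewrite (min_idPl uab) (max_idPr uab); move: cab; rewrite in_itv.
    by exists r; [move: rab; rewrite in_itv|rewrite Fc rc].
  - have [|c cab Fc] := @MVT_segment R F h _ _ (ltW uba) (fun x _ => dF x).
      exact: continuous_subspaceT.
    have [||r rab rc] := @IVT R u a b c ab; first exact: continuous_subspaceT.
      by rewrite (min_idPr (ltW uba)) (max_idPl (ltW uba)); move: cab; rewrite in_itv.
    by exists r; [move: rab; rewrite in_itv|rewrite -opprB Fc rc; ring].
have [ig ub] := ug _ _ ab.
rewrite Fr ub -segintZ// -segintB; [|exact: segintegrableZ|exact: ighu].
apply: le_trans (le_norm_segint _) _.
  by apply: segintegrableB; [exact: segintegrableZ|exact: ighu].
rewrite -segintZ; last exact: segintegrable_norm.
apply: le_segint.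
- by apply: segintegrable_norm; apply: segintegrableB; [exact: segintegrableZ|exact: ighu].
- by apply: segintegrableZ; exact: segintegrable_norm.
move=> t tab; rewrite mulrC -mulrBr normrM mulrC ler_wpM2r//.
have := hz _ rab; have := hz _ tab; rewrite !ltr_norml => /andP[? ?] /andP[? ?].
by rewrite ler_norml; apply/andP; split; lra.
Qed.

(** Polarization: [2 u v = (u + v)^2 - u^2 - v^2], and squares fall under the chain rule
    [ac_comp]. *)
Lemma acM u v f g : ac u f -> ac v g ->
  ac (fun x => u x * v x) (fun x => f x * v x + u x * g x).
Proof.
move=> uf vg.
have sq w k : ac w k -> ac (fun x => w x ^+ 2) (fun x => k x * (2 * w x)).
  move=> wk; apply: (@ac_comp (fun x => x ^+ 2) (fun x => 2 * x)) => //.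
    by move=> x; apply: cvgM; [exact: cvg_cst|exact: cvg_id].
  by move=> x; apply: is_derive_eq; rewrite /GRing.scale/= mulr1; ring.
have := acZ 2^-1 (acB (sq _ _ (acD uf vg)) (acD (sq _ _ uf) (sq _ _ vg))).
set U := fun x : R => _; set V := fun x : R => _.
have -> : U = fun x => u x * v x by apply/funext => x; rewrite /U; field.
by have -> : V = fun x => f x * v x + u x * g x by apply/funext => x; rewrite /V; field.
Qed.

Lemma ac_derive F f : continuous f -> (forall x, is_derive x 1 F (f x)) ->
  ac F f.
Proof.
move=> cf dF.
have cid : ac (@id R) (fun=> 1).
  move=> x y xy; split; first by apply: segintegrable_cont; exact: cst_continuous.
  by rewrite segint_cst// mul1r.
by apply: ac_eq (ac_comp cid cf dF) => x; rewrite mul1r.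
Qed.

Lemma ac0_cst u f x y : ac u f -> x <= y ->
  (forall t, x <= t <= y -> f t = 0) -> u y = u x.
Proof.
move=> uf xy f0; apply/eqP; rewrite -subr_eq0 (uf _ _ xy).2.
by rewrite (eq_segint (g := fun=> 0))// segint_cst// mul0r.
Qed.

Lemma continuous_derive F f : (forall x, is_derive x 1 F (f x)) -> continuous F.
Proof.
by move=> dF x; apply: differentiable_continuous; apply/derivable1_diffP; have [] := dF x.
Qed.

End absolute_continuity.

(** * Differentiation rules in pointwise form *)

Section scalar_derivatives.
Context {R : realType}.
Implicit Types (f g h : R -> R) (x a b : R).

Lemma is_derive_add f g x a b : is_derive x 1 f a -> is_derive x 1 g b ->
  is_derive x 1 (fun x => f x + g x) (a + b).
Proof. by move=> fa gb; exact: is_deriveD. Qed.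

Lemma is_derive_sub f g x a b : is_derive x 1 f a -> is_derive x 1 g b ->
  is_derive x 1 (fun x => f x - g x) (a - b).
Proof. by move=> fa gb; exact: is_deriveB. Qed.

Lemma is_derive_mul f g x a b : is_derive x 1 f a -> is_derive x 1 g b ->
  is_derive x 1 (fun x => f x * g x) (a * g x + f x * b).
Proof.
move=> fa gb; apply: (@is_derive_eq _ _ _ _ _ _ _ _ (is_deriveM fa gb)).
by rewrite /GRing.scale/=; ring.
Qed.

Lemma is_derive_scale k f x a : is_derive x 1 f a ->
  is_derive x 1 (fun x => k * f x) (k * a).
Proof. by move=> fa; exact: is_deriveZ. Qed.

Lemma is_derive_inv f x a : f x != 0 -> is_derive x 1 f a ->
  is_derive x 1 (fun x => (f x)^-1) (- a / f x ^+ 2).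
Proof.
move=> fx0 fa; apply: (@is_derive_eq _ _ _ _ _ _ _ _ (is_deriveV fx0 fa)).
by rewrite /GRing.scale/=; field.
Qed.

Lemma is_derive_circ f g x a b : is_derive (g x) 1 f a -> is_derive x 1 g b ->
  is_derive x 1 (fun x => f (g x)) (a * b).
Proof. exact: is_derive1_comp. Qed.

Lemma is_derive_sqrt f x a : 0 < f x -> is_derive x 1 f a ->
  is_derive x 1 (fun x => Num.sqrt (f x)) (a / (2 * Num.sqrt (f x))).
Proof.
move=> fx0 fa; have := is_derive_circ (is_derive1_sqrt fx0) fa.
by rewrite mulrC.
Qed.

Lemma is_derive_affine k a x : is_derive x 1 (fun t => k * t + a) k.
Proof. by apply: is_derive_eq; rewrite /GRing.scale/= addr0 mulr1. Qed.

End scalar_derivatives.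

(** * Primitives, square integrable functions and derivatives on [0, 1] *)

Section primitives.
Context {R : realType}.
Implicit Types (F f u v : R -> R) (x y : R).
Notation mu := (@lebesgue_measure R).

Lemma ac_exists f : (forall x y, segintegrable f x y) ->
  exists2 F, ac F f & F 0 = 0.
Proof.
(* [segint] is an integral over a set, hence 0 on a reversed segment: the orientation has to be put
   in by hand. *)
move=> fi; pose F x := if 0 <= x then segint f 0 x else - segint f x 0.
exists F; last by rewrite /F lexx segint_xx.
move=> x y xy; split; first exact: fi.
rewrite /F; case: (leP 0 x) => x0; case: (leP 0 y) => y0.
- by rewrite (segint_add x0 xy)// addrC addKr.
- by lra.
- by rewrite opprK addrC -(segint_add (ltW x0) y0).
- by rewrite (segint_add xy (ltW y0))//; ring.
Qed.

Lemma ac_is_derive F f x : ac F f -> {for x, continuous f} ->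
  is_derive x 1 F (f x).
Proof.
move=> Ff cf.
have x11 : x < x + 1 by lra.
have xm1 : x - 1 < x by lra.
have [|dG dGE] := @continuous_FTC1_closed R f (x - 1) x (x + 1) x11 _ xm1 cf.
  by apply: (Ff _ _ _).1; lra.
set G := fun t : R => _ in dG dGE.
have GE : \forall t \near x, G t + F (x - 1) = F t.
  near=> t.
  have xt : x - 1 <= t by near: t; exact: lt_le_nbhsr.
  by have := (Ff _ _ xt).2; rewrite /segint /G => <-; rewrite subrK.
have dG' : is_derive x 1 G (f x) by rewrite -dGE derive1E; exact/derivableP.
have := is_derive_add dG' (is_derive_cst (F (x - 1)) x 1).
by rewrite addr0; exact: near_eq_is_derive.
Unshelve. all: by end_near. Qed.

Lemma primitive_exists f : continuous f -> exists F, forall x, is_derive x 1 F (f x).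
Proof.
move=> cf; have [|F Ff _] := @ac_exists f.
  by move=> x y; exact: segintegrable_cont.
by exists F => x; apply: ac_is_derive Ff _; exact: cf.
Qed.

(** Lebesgue differentiation: almost everywhere a density is the derivative of its integral, here a
    constant. [f] is cut off to [0, 1] because the integral to be differentiated starts at minus
    infinity. *)
Lemma ac_uniq_ae F f : ac F f -> (forall x, 0 <= x <= 1 -> F x = F 0) ->
  {ae mu, forall x, x \in `]0, 1[ -> f x = 0}.
Proof.
move=> Ff F0; pose g := f \_ `[0, 1].
have ig : mu.-integrable setT (EFin \o g).
  rewrite /g -restrict_EFin; apply/integrable_restrict => //=; rewrite setTI.
  exact: (Ff _ _ ler01).1.
have igS A : measurable A -> mu.-integrable A (EFin \o g).
  by move=> mA; apply: integrableS ig.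
have lg : locally_integrable setT g by apply: integrable_locally => //; exact: (Ff _ _ ler01).1.
have := @FTC1 R g (-oo)%O (fun y => igS _ (measurable_itv _)) lg.
move=> /= FTC; apply: filterS FTC; first exact: (ae_filter_ringOfSetsType mu).
move=> x /(_ (ltNyr _))[dG dGE] x01.
have -> : f x = g x by rewrite /g patchE mem_set//=; apply: subset_itv_oo_cc.
rewrite -dGE derive1E.
transitivity ('D_1 (cst (0 : R)) x); last by rewrite derive_cst.
apply: near_eq_derive; near=> t.
have /andP[t0 t1] : 0 < t < 1.
  have : t \in `]0, 1[ by near: t; exact: near_in_itvoo.
  by rewrite in_itv.
have -> : \int[mu]_(s in `]-oo, t]) g s = segint f 0 t.
  rewrite /g /segint -Rintegral_mkcondr; congr (Rintegral _ _ _).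
  apply/seteqP; split => s /=; rewrite !in_itv/=.
    by move=> [st /andP[-> _]].
  by move=> /andP[s0 st]; split => //; rewrite s0 (le_trans st (ltW t1)).
by rewrite -(Ff _ _ (ltW t0)).2 F0 ?subrr// !ltW.
Unshelve. all: by end_near. Qed.

Lemma L2_segintegrable_sqr u : L2 u ->
  measurable_fun (`[0, 1] : set R) u /\ segintegrable (fun x => u x ^+ 2) 0 1.
Proof.
move=> uL; have mu_ : measurable_fun (`[0, 1] : set R) u.
  have := sub_Lfun_mfun uL; rewrite inE => /= h.
  by apply/measurable_restrictT.
split => //.
have /Lfun2_integrable_sqr := uL.
move=> h; apply: (@eq_integrable _ _ _ mu _ _ (EFin \o (fun x => (u \_ `[0, 1]) x ^+ 2))); last first.
  exact: integrableS h.
- by move=> x /[!inE] x01 /=; rewrite patchE mem_set.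
- by [].
Qed.

(** On a segment, [|u| <= 1 + u^2] because [(|u| - 1)^2 >= 0]. *)
Lemma L2_segintegrable u : L2 u -> segintegrable u 0 1.
Proof.
move=> /L2_segintegrable_sqr[mu_ iu2].
apply: (@le_integrable _ _ _ mu _ _ _ (EFin \o (fun x => 1 + u x ^+ 2))) => //.
- exact/measurable_EFinP.
- move=> x _ /=; rewrite lee_fin [leRHS]ger0_norm; last by rewrite addr_ge0// sqr_ge0.
  have := sqr_ge0 (`|u x| - 1); rewrite sqrrB real_normK ?num_real//.
  by have := normr_ge0 (u x); lra.
- apply: segintegrableD => //; apply: segintegrable_cont; exact: cst_continuous.
Qed.

Lemma continuous_L2 u : {within `[0, 1], continuous u} -> L2 u.
Proof.
move=> cu; rewrite /L2 inE; apply/andP; split; rewrite inE/=.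
  apply/(measurable_restrictT u (measurable_itv _)).
  exact: subspace_continuous_measurable_fun.
have /integrableP[_] : segintegrable (fun x => u x * u x) 0 1.
  exact: segintegrableM (segintegrable_within cu).
move=> iu2; rewrite /finite_norm unlock; apply: poweR_lty.
apply: le_lt_trans iu2; rewrite [leRHS]integral_mkcond/=.
rewrite le_eqVlt; apply/orP; left; apply/eqP; apply: eq_integral => x _.
rewrite /patch; case: ifPn => _ /=; last by rewrite normr0 powR0.
by rewrite powR_mulrn// expr2 normrM.
Qed.

Lemma derivative01_eq u U p x : (forall t, 0 <= t <= 1 -> u t = U t) ->
  is_derive x 1 U p -> 0 <= x <= 1 -> derivative01 u x = p.
Proof.
move=> uU [dU <-] x01; rewrite /derivative01.
(* The limit is unique only if [x] is a limit point of the rest of [0, 1]. Points are found on the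
   right of [x] when [x <= 1 / 2] and on its left otherwise; a step of at most 1/2 stays in the
   segment. *)
have PF : ProperFilter (within `[0, 1] x^').
  apply: Build_ProperFilter_ex => A /nbhs_ballP[e /= e0 Ae].
  have [xh|hx] := leP x (2^-1 : R).
  - have m0 : 0 < Num.min (e / 2) (2^-1 : R) by rewrite lt_min; apply/andP; split; lra.
    exists (x + Num.min (e / 2) 2^-1); apply: Ae.
    + rewrite /ball/= opprD addrA subrr sub0r normrN gtr0_norm// gt_min; apply/orP; left; lra.
    + by rewrite -subr_eq0 addrAC subrr add0r gt_eqF.
    + rewrite /= in_itv/=; move: m0; have : Num.min (e / 2) 2^-1 <= 2^-1 :> R by rewrite ge_min lexx orbT.
      by lra.
  - have m0 : 0 < Num.min (e / 2) (2^-1 : R) by rewrite lt_min; apply/andP; split; lra.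
    exists (x - Num.min (e / 2) 2^-1); apply: Ae.
    + rewrite /ball/= opprB addrC subrK gtr0_norm// gt_min; apply/orP; left; lra.
    + by rewrite -subr_eq0 addrAC subrr add0r oppr_eq0 gt_eqF.
    + rewrite /= in_itv/=; move: m0; have : Num.min (e / 2) 2^-1 <= 2^-1 :> R by rewrite ge_min lexx orbT.
      by lra.
apply/cvg_lim => //; apply/cvgrPdist_lt => e e0.
have /cvgrPdist_lt/(_ _ e0)/nbhs_ballP[d /= d0 hd] := dU.
apply/nbhs_ballP; exists d => //= y yd yx; rewrite in_itv/= => y01.
have yx0 : y - x != 0 by rewrite subr_eq0.
have := hd (y - x); rewrite /ball/= sub0r normrN distrC => /(_ yd yx0).
by rewrite /GRing.scale/= mulr1 subrK !uU// [_^-1 * _]mulrC.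
Qed.

End primitives.

(** * Test functions and the du Bois-Reymond lemma *)

Section smooth_functions.
Context {R : realType}.
Implicit Types (f g : R -> R) (x a b : R).

(** An explicit chain of derivatives, so that closure under products and affine substitutions is an
    induction on [n]. *)
Fixpoint Cn n f : Prop :=
  if n is m.+1 then
    exists2 g, (forall x, is_derive x 1 f (g x)) & Cn m g
  else True.

Definition smooth f := forall n, Cn n f.

Lemma CnW n f : Cn n.+1 f -> Cn n f.
Proof. by elim: n f => //= n ih f [g fg /ih gn]; exists g. Qed.

Lemma smooth_derivable f : smooth f -> forall n x, derivable (derive1n n f) x 1.
Proof.
move=> sf n x; have := sf n.+1; rewrite /derive1n.
elim: n f {sf} => [|n ih] f; first by move=> [g fg _]; have [] := fg x.
move=> [g fg Cg]; rewrite iterSr.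
have -> : derive1 f = g by apply/funext => t; rewrite derive1E; have [_ ->] := fg t.
exact: ih Cg.
Qed.

Lemma smooth_derive f : smooth f ->
  (forall x, is_derive x 1 f (derive1 f x)) /\ smooth (derive1 f).
Proof.
move=> sf; split=> [x|n].
  by rewrite derive1E; apply/derivableP; have [g /(_ x)[]] := sf 1%N.
have [g fg] := sf n.+1.
by have -> : derive1 f = g by apply/funext => t; rewrite derive1E; have [_ ->] := fg t.
Qed.

Lemma smooth_continuous f : smooth f -> continuous f.
Proof. by move=> /(_ 1%N)[g fg _]; exact: continuous_derive fg. Qed.

Lemma smooth_primitive f g : (forall x, is_derive x 1 f (g x)) -> smooth g ->
  smooth f.
Proof. by move=> fg sg [|n] //; exists g. Qed.

Lemma smoothD f g : smooth f -> smooth g -> smooth (fun x => f x + g x).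
Proof.
move=> + + n; elim: n f g => //= n ih f g sf sg.
have [df sf'] := smooth_derive sf; have [dg sg'] := smooth_derive sg.
exists (fun x => derive1 f x + derive1 g x); last exact: ih.
by move=> x; exact: is_derive_add.
Qed.

Lemma CnM n f g : Cn n f -> Cn n g -> Cn n (fun x => f x * g x).
Proof.
have D m : forall f g, Cn m f -> Cn m g -> Cn m (fun x => f x + g x).
  elim: m => //= m ih {}f {}g [f' ff' f'm] [g' gg' g'm].
  exists (fun x => f' x + g' x); last exact: ih.
  by move=> x; exact: is_derive_add.
elim: n f g => //= n ih f g Cf Cg.
have [Cf1 Cg1] := (@CnW n f Cf, @CnW n g Cg).
case: Cf => f' ff' f'm; case: Cg => g' gg' g'm.
exists (fun x => f' x * g x + f x * g' x); last by apply: D; exact: ih.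
by move=> x; exact: is_derive_mul.
Qed.

Lemma smoothM f g : smooth f -> smooth g -> smooth (fun x => f x * g x).
Proof. by move=> sf sg n; exact: CnM. Qed.

Lemma smooth_cst k : smooth (fun=> k).
Proof.
move=> n; elim: n k => //= n ih k; exists (fun=> 0) => //.
by move=> x; exact: is_derive_cst.
Qed.

Lemma smooth_affine f k a : smooth f -> smooth (fun x => f (k * x + a)).
Proof.
suff H n : forall f, smooth f -> Cn n (fun x => f (k * x + a)) by move=> ? n; exact: H.
elim: n => //= n ih {}f sf; have [df sf'] := smooth_derive sf.
exists (fun x => derive1 f (k * x + a) * k).
  by move=> x; apply: is_derive_circ (df _) (is_derive_affine _ _ _).
by apply: CnM; [exact: ih|exact: smooth_cst].
Qed.

Lemma is_derive_flat f K : (forall h, `|h| <= 1 -> `|f h| <= K * h ^+ 2) ->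
  is_derive (0 : R) 1 f 0.
Proof.
move=> fK.
have f0 : f 0 = 0.
  by apply/eqP; rewrite -normr_le0; have := fK 0; rewrite normr0 expr0n mulr0; apply.
have K0 : 0 <= K by have := fK 1; rewrite normr1 expr1n mulr1 => /(_ (lexx _)); apply: le_trans.
have H : h^-1 *: (f (h *: 1 + 0) - f 0) @[h --> 0^'] --> (0 : R).
  apply/cvgrPdist_lt => e e0; near=> h.
  have h0 : h != 0 by near: h; exact: nbhs_dnbhs_neq.
  have h1 : `|h| <= 1 by near: h; exact: dnbhs0_le.
  have he : `|h| < e / (K + 1).
    by near: h; apply: dnbhs0_lt; rewrite divr_gt0//; lra.
  rewrite f0 subr0 addr0 sub0r normrN /GRing.scale/= mulr1 normrM normfV.
  rewrite mulrC ltr_pdivrMr ?normr_gt0//; apply: le_lt_trans (fK _ h1) _.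
  rewrite -[h ^+ 2]real_normK ?num_real// expr2 mulrA ltr_pM2r ?normr_gt0//.
  move: he; rewrite ltr_pdivlMr; last by lra.
  by have := normr_ge0 h; nra.
apply: DeriveDef; last exact: cvg_lim H.
by apply/cvg_ex; exists 0.
Unshelve. all: by end_near. Qed.

(** The polynomial factor makes the family stable under differentiation ([p] becomes
    [X^2 (p - p')]), so smoothness is an induction over all [p] at once; [p = 1] is the usual flat
    function. *)
Definition expinv (p : {poly R}) x := if 0 < x then p.[x^-1] * expR (- x^-1) else 0.

(** With [t = 1 / h >= 1] and [N] the size of [p], [|p(t)| <= M t^N] while
    [exp t >= t^(N+2) / (N+2)!]. The two spare powers give the factor [h^2], hence a zero derivative
    at the junction 0. *)
Lemma expinv_flat p : exists K, forall h, `|h| <= 1 -> `|expinv p h| <= K * h ^+ 2.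
Proof.
pose M := \sum_(i < size p) `|p`_i|.
have M0 : 0 <= M by apply: sumr_ge0.
pose N := size p.
exists (M * (N.+2)`!%:R) => h h1; rewrite /expinv; case: ifPn => [h0|_]; last first.
  by rewrite normr0 mulr_ge0 ?sqr_ge0// mulr_ge0.
set t := h^-1; have t0 : 0 < t by rewrite invr_gt0.
have t1 : 1 <= t by rewrite invf_ge1// -(gtr0_norm h0).
have pM : `|p.[t]| <= M * t ^+ N.
  rewrite horner_coef; apply: le_trans (ler_norm_sum _ _ _) _.
  rewrite mulr_suml; apply: ler_sum => i _; rewrite normrM ler_wpM2l//.
  by rewrite ger0_norm ?exprn_ge0 ?(ltW t0)// ler_weXn2l// ltnW.
have et := expR_ge1Dxn N.+1 (ltW t0).
have F0 : 0 < (N.+2)`!%:R :> R by rewrite ltr0n fact_gt0.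
have tN : t ^+ N.+2 <= (N.+2)`!%:R * expR t.
  by rewrite -ler_pdivrMl// mulrC; lra.
rewrite normrM (ger0_norm (expR_ge0 _)) expRN.
have -> : h ^+ 2 = (t ^+ 2)^-1 by rewrite /t exprVn invrK.
rewrite ler_pdivrMr ?expR_gt0// mulrAC ler_pdivlMr ?exprn_gt0//.
rewrite -mulrA; apply: le_trans (_ : M * t ^+ N * t ^+ 2 <= _).
  by rewrite ler_wpM2r// exprn_ge0// ltW.
by rewrite -mulrA -exprD addn2 ler_wpM2l.
Qed.

Lemma is_derive_expinv p x :
  is_derive x 1 (expinv p) (expinv ('X^2 * (p - p^`())) x).
Proof.
case: (ltgtP x 0) => [x0|x0|->].
- rewrite {2}/expinv ltNge (ltW x0)/=.
  apply: (near_eq_is_derive _ (is_derive_cst (0 : R) x 1)).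
  near=> t; rewrite /expinv; case: ifPn => // t0.
  have tn : t < 0 by near: t; exact: lt_nbhsl.
  by move: tn; rewrite ltNge (ltW t0).
- rewrite {2}/expinv x0.
  apply: (@near_eq_is_derive _ _ _ (fun x => p.[x^-1] * expR (- x^-1))).
    near=> t; rewrite /expinv ifT//.
    by near: t; exact: lt_nbhsr.
  have xn0 : x != 0 by rewrite gt_eqF.
  have dv := is_derive_inv xn0 (is_derive_id x 1).
  have dp := is_derive_circ (is_derive_poly p x^-1) dv.
  have de := @is_derive_circ R expR (fun t => -1 * t^-1) x _ _ (is_derive_expR _) (is_derive_scale (-1) dv).
  have := is_derive_mul dp de.
  have -> : (fun t => p.[t^-1] * expR (-1 * t^-1)) = (fun t => p.[t^-1] * expR (- t^-1)).
    by apply/funext => t; rewrite mulN1r.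
  move=> /is_derive_eq; apply.
  rewrite hornerM hornerXn hornerD hornerN !mulN1r.
  by field.
have [K /is_derive_flat] := expinv_flat p.
by rewrite /expinv ltxx.
Unshelve. all: by end_near. Qed.

Lemma smooth_expinv p : smooth (expinv p).
Proof.
move=> n; elim: n p => //= n ih p.
exists (expinv ('X^2 * (p - p^`()))) => //; exact: is_derive_expinv.
Qed.

Definition bump a b x := expinv 1 (1 * x + - a) * expinv 1 (-1 * x + b).

Lemma smooth_bump a b : smooth (bump a b).
Proof. by apply: smoothM; apply: smooth_affine; exact: smooth_expinv. Qed.

Lemma bump_ge0 a b x : 0 <= bump a b x.
Proof.
rewrite /bump /expinv !hornerE; by case: ifP => _; case: ifP => _; rewrite ?(mulr0,mul0r)//.
Qed.

Lemma bump_gt0 a b x : a < x < b -> 0 < bump a b x.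
Proof.
move=> /andP[ax xb]; rewrite /bump /expinv !hornerE !ifT; [|lra..].
by rewrite !mulr_gt0 ?expR_gt0.
Qed.

Lemma bump_out a b x : ~~ (a < x < b) -> bump a b x = 0.
Proof.
rewrite negb_and -!leNgt /bump /expinv => /orP[xa|bx].
  by rewrite ifF ?mul0r//; apply/negbTE; rewrite -leNgt; lra.
by rewrite [X in _ * X]ifF ?mulr0//; apply/negbTE; rewrite -leNgt; lra.
Qed.

End smooth_functions.

(** * Functions with compact support in ]0, 1[ and orthogonality relations *)

Section test_functions.
Context {R : realType}.
Implicit Types (f g u v phi chi : R -> R) (x a b : R).
Notation mu := (@lebesgue_measure R).

(** The supply of test functions for the orthogonality arguments: the support has explicit bounds,
    which survive derivatives, sums and suitable primitives. *)
Definition compact_smooth phi := smooth phi /\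
  exists a b, [/\ 0 < a, b < 1 & forall x, ~~ (a <= x <= b) -> phi x = 0].

Lemma compact_smooth_test phi : compact_smooth phi -> test_function phi.
Proof.
move=> [sphi [a [b [a0 b1 phi0]]]]; split; first exact: smooth_derivable.
apply: (@subset_trans _ `[a, b]); last first.
  by move=> x /=; rewrite !in_itv/=; lra.
have cab : closed (`[a, b] : set R) by exact: interval_closed.
rewrite [X in _ `<=` X]((closure_id _).1 cab).
apply: closureS => x /=; rewrite in_itv/= => /eqP phix.
by apply/negPn/negP => /phi0.
Qed.

Lemma compact_smooth_derive phi : compact_smooth phi ->
  compact_smooth (derive1 phi).
Proof.
move=> [sphi [a [b [a0 b1 phi0]]]]; have [dphi sphi'] := smooth_derive sphi.
split=> //; exists a, b; split=> // x xab; rewrite derive1E.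
rewrite -(@near_eq_derive _ _ _ (cst (0 : R))) ?derive_cst//.
move: xab; rewrite negb_and -!ltNge => /orP[xa|bx]; near=> t; rewrite phi0//.
  rewrite negb_and -!ltNge; apply/orP; left; near: t; exact: lt_nbhsl.
rewrite negb_and -!ltNge; apply/orP; right; near: t; exact: lt_nbhsr.
Unshelve. all: by end_near. Qed.

Lemma compact_smooth_ends phi : compact_smooth phi -> phi 0 = 0 /\ phi 1 = 0.
Proof. by move=> [_ [a [b [a0 b1 phi0]]]]; split; apply: phi0; apply/negP; lra. Qed.

Lemma compact_smooth_ac phi : compact_smooth phi -> ac phi (derive1 phi).
Proof.
move=> [sphi _]; have [dphi sphi'] := smooth_derive sphi.
by apply: ac_derive => //; exact: smooth_continuous.
Qed.

Lemma compact_smooth_continuous phi : compact_smooth phi -> continuous phi.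
Proof. by move=> [/smooth_continuous]. Qed.

Lemma compact_smooth_bump a b : 0 < a -> b < 1 -> compact_smooth (bump a b).
Proof.
move=> a0 b1; split; first exact: smooth_bump.
by exists a, b; split=> // x xab; apply: bump_out; apply: contra xab; lra.
Qed.

Lemma compact_smoothB phi chi k : compact_smooth phi -> compact_smooth chi ->
  compact_smooth (fun x => phi x + k * chi x).
Proof.
move=> [sphi [a [b [a0 b1 phi0]]]] [schi [c [d [c0 d1 chi0]]]]; split.
  by apply: smoothD => //; apply: smoothM => //; exact: smooth_cst.
exists (Num.min a c), (Num.max b d); split.
- by rewrite lt_min a0.
- by rewrite gt_max b1.
- move=> x; rewrite negb_and -!ltNge lt_min gt_max => H.
  rewrite phi0 ?chi0 ?mulr0 ?addr0//; rewrite negb_and -!ltNge.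
    by case/orP: H => /andP[? ?]; apply/orP; [left|right].
  by case/orP: H => /andP[? ?]; apply/orP; [left|right].
Qed.

(** A primitive vanishing at 0 is constant on either side of the support; the zero mean makes the
    right-hand constant 0 as well. *)
Lemma compact_smooth_primitive chi : compact_smooth chi ->
  segint chi 0 1 = 0 -> exists2 phi, compact_smooth phi & derive1 phi = chi.
Proof.
move=> chiT chi0; have cchi := compact_smooth_continuous chiT.
have [F dF] := primitive_exists cchi.
have aF := ac_derive cchi dF.
have dG x : is_derive x 1 (fun x => F x - F 0) (chi x).
  by rewrite -[chi x]subr0; exact: is_derive_sub.
exists (fun x => F x - F 0); last first.
  by apply/funext => x; rewrite derive1E; have [_ ->] := dG x.
move: chiT => [schi [a [b [a0 b1 chiab]]]]; split; first exact: smooth_primitive dG schi.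
exists a, b; split => // x; rewrite negb_and -!ltNge => /orP[xa|bx].
  apply/eqP; rewrite subr_eq0; apply/eqP.
  have [x0|x0] := leP x 0.
    apply/esym; apply: (ac0_cst aF x0) => t /andP[_ t0]; apply: chiab.
    by apply/negP; lra.
  apply: (ac0_cst aF (ltW x0)) => t /andP[_ t0]; apply: chiab.
  by apply/negP; lra.
have F1 : F 1 = F 0 by apply/eqP; rewrite -subr_eq0 (aF _ _ ler01).2 chi0.
rewrite -F1; apply/eqP; rewrite subr_eq0; apply/eqP.
have [x1|x1] := leP x 1.
  apply/esym; apply: (ac0_cst aF x1) => t /andP[xt _]; apply: chiab.
  by apply/negP; lra.
apply: (ac0_cst aF (ltW x1)) => t /andP[xt _]; apply: chiab.
by apply/negP; lra.
Qed.

Lemma segint_gt0 g c : continuous g -> (forall x, 0 <= x <= 1 -> 0 <= g x) ->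
  0 <= c <= 1 -> 0 < g c -> 0 < segint g 0 1.
Proof.
move=> cg g0 c01 gc.
have /cvgrPdist_lt/(_ (g c / 2))[|d /= d0 hd] := cg c; first by rewrite divr_gt0.
have [a [b [a0 ab b1 gab]]] : exists a b, [/\ 0 <= a, a < b, b <= 1 &
    forall t, a <= t <= b -> g c / 2 <= g t].
  have H t : `|c - t| < d -> g c / 2 <= g t.
    by move=> /hd; rewrite ltr_norml; lra.
  pose e := Num.min (d / 2) (2^-1 : R).
  have e0 : 0 < e by rewrite lt_min; apply/andP; split; lra.
  have ed : e <= d / 2 by rewrite ge_min lexx.
  have e2 : e <= 2^-1 by rewrite ge_min lexx orbT.
  have [ch|hc] := leP c (2^-1 : R).
    exists c, (c + e); split; [lra..|].
    by move=> t tab; apply: H; rewrite ltr_norml; lra.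
  exists (c - e), c; split; [lra..|].
  by move=> t tab; apply: H; rewrite ltr_norml; lra.
have ig x y : segintegrable g x y by exact: segintegrable_cont.
rewrite (segint_add a0 (le_trans (ltW ab) b1) (ig _ _)).
rewrite (segint_add (ltW ab) b1 (ig _ _)).
have I1 : 0 <= segint g 0 a by apply: segint_ge0 => x xa; apply: g0; lra.
have I3 : 0 <= segint g b 1 by apply: segint_ge0 => x xa; apply: g0; lra.
have : segint (fun=> g c / 2) a b <= segint g a b.
  by apply: le_segint => //; apply: segintegrable_cont; exact: cst_continuous.
rewrite (segint_cst _ (ltW ab)).
have : 0 < g c / 2 * (b - a) by rewrite mulr_gt0//; lra.
by lra.
Qed.

Lemma ortho_test_eq0 f : continuous f ->
  (forall phi, compact_smooth phi -> segint (fun x => f x * phi x) 0 1 = 0) ->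
  forall x, 0 <= x <= 1 -> f x = 0.
Proof.
move=> cf fphi.
have pos g c : continuous g ->
    (forall phi, compact_smooth phi -> segint (fun x => g x * phi x) 0 1 = 0) ->
    0 < c < 1 -> g c <= 0.
  move=> cg gphi c01; rewrite leNgt; apply/negP => gc.
  have /cvgrPdist_lt/(_ (g c))[//|d /= d0 hd] := cg c.
  (* Within distance [e] of [c] the function [g] is positive; the radius [e / 2] keeps the bump
     strictly inside ]0, 1[. *)
  pose e := Num.min d (Num.min c (1 - c)).
  have e0 : 0 < e by rewrite !lt_min; apply/and3P; split; lra.
  have ed : e <= d by rewrite ge_min lexx.
  have ec : e <= c by rewrite !ge_min lexx orbT.
  have e1 : e <= 1 - c by rewrite !ge_min lexx !orbT.
  pose phi := bump (c - e / 2) (c + e / 2).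
  have phiT : compact_smooth phi by apply: compact_smooth_bump; lra.
  have := gphi _ phiT; apply/eqP; rewrite gt_eqF//.
  apply: (@segint_gt0 _ c) => //.
  - by move=> x; apply: cvgM; [exact: cg|exact: compact_smooth_continuous].
  - move=> x _; have [xc|/bump_out] := boolP (c - e / 2 < x < c + e / 2); last first.
      by rewrite -/phi /phi => ->; rewrite mulr0.
    rewrite mulr_ge0 ?bump_ge0//; have := hd x; rewrite /ball_/= !ltr_norml => H.
    by have := H _; lra.
  - by lra.
  - by rewrite mulr_gt0//; apply: bump_gt0; lra.
have f0 x : 0 < x < 1 -> f x = 0.
  move=> x01; apply/eqP; rewrite eq_le (pos f)//= -oppr_le0.
  apply: (pos (fun x => - f x)) => // [t|phi phiT]; first by apply: cvgN; exact: cf.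
  rewrite -[RHS](mulr0 (-1)) -[in RHS](fphi _ phiT) -segintZ; last first.
    apply: segintegrable_cont => t.
    by apply: cvgM; [exact: cf|exact: compact_smooth_continuous].
  by apply: eq_segint => t _; rewrite mulN1r mulNr.
(* Test functions see only the open interval; the two endpoints follow by continuity of [f]. *)
have lim0 c : 0 < `|f c| -> (forall d, 0 < d -> exists2 t, `|c - t| < d & f t = 0) -> False.
  move=> fc near0; have /cvgrPdist_lt/(_ _ fc)[d /= d0 hd] := cf c.
  have [t ct ft] := near0 _ d0; have := hd t ct.
  by rewrite ft subr0 ltxx.
move=> x x01; apply/eqP; rewrite -normr_le0 leNgt; apply/negP => fx.
apply: (lim0 x fx) => d d0.
have m0 : 0 < Num.min (d / 2) (2^-1 : R) by rewrite lt_min; apply/andP; split; lra.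
have md : Num.min (d / 2) (2^-1 : R) <= d / 2 by rewrite ge_min lexx.
have m2 : Num.min (d / 2) (2^-1 : R) <= 2^-1 by rewrite ge_min lexx orbT.
have [x0|x0] := eqVneq x 0.
  exists (Num.min (d / 2) 2^-1); last by apply: f0; lra.
  by rewrite x0 ltr_norml; lra.
have [x1|x1] := eqVneq x 1.
  exists (1 - Num.min (d / 2) 2^-1); last by apply: f0; lra.
  by rewrite x1 ltr_norml; lra.
exists x; first by rewrite subrr normr0.
by apply: f0; rewrite !lt_neqAle eq_sym x0 x1; case/andP: x01 => -> ->.
Qed.

(** Subtracting a multiple of a fixed bump [eta0] gives a test function zero mean, hence makes it
    the derivative of another one. Each use of this lowers by one the order of derivatives in the
    orthogonality and costs one coefficient of the affine function. *)
Lemma ortho_test2_affine f : continuous f ->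
  (forall phi, compact_smooth phi ->
     segint (fun x => f x * derive1 (derive1 phi) x) 0 1 = 0) ->
  exists A B, forall x, 0 <= x <= 1 -> f x = A + B * x.
Proof.
move=> cf fphi.
pose eta0 := bump (4^-1 : R) (3 / 4).
have eta0T : compact_smooth eta0 by apply: compact_smooth_bump; lra.
have eta0I : 0 < segint eta0 0 1.
  apply: (@segint_gt0 _ (2^-1)); first exact: compact_smooth_continuous.
  - by move=> x _; exact: bump_ge0.
  - by lra.
  - by apply: bump_gt0; lra.
have ci phi : compact_smooth phi -> segintegrable phi 0 1.
  by move=> /compact_smooth_continuous; exact: segintegrable_cont.
have cfi g phi : continuous g -> compact_smooth phi ->
    segintegrable (fun x => g x * phi x) 0 1.
  move=> cg /compact_smooth_continuous cp.
  by apply: segintegrable_cont => x; apply: cvgM; [exact: cg|exact: cp].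
have comb g phi chi k : continuous g -> compact_smooth phi -> compact_smooth chi ->
    segint (fun x => g x * (phi x + k * chi x)) 0 1 =
    segint (fun x => g x * phi x) 0 1 + k * segint (fun x => g x * chi x) 0 1.
  move=> cg phiT chiT; rewrite -segintZ; last exact: cfi.
  rewrite -segintD; [|exact: cfi|by apply: segintegrableZ; exact: cfi].
  by apply: eq_segint => x _; ring.
have one phi : segint phi 0 1 = segint (fun x => 1 * phi x) 0 1.
  by apply: eq_segint => x _; rewrite mul1r.
have c1 : continuous (fun _ : R => 1 : R) by exact: cst_continuous.
have zero_mean phi : compact_smooth phi ->
    exists2 F, compact_smooth F &
      forall x, derive1 F x = phi x + - (segint phi 0 1 / segint eta0 0 1) * eta0 x.
  move=> phiT; have [||F FT F'] := @compact_smooth_primitive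
      (fun x => phi x + - (segint phi 0 1 / segint eta0 0 1) * eta0 x).
  - exact: compact_smoothB.
  - by rewrite one comb// -!one mulNr divfK ?subrr// gt_eqF.
  - by exists F => // x; rewrite F'.
(* The integral of [x * chi'] is minus that of [chi], so adding [C * x] cancels the contribution of
   the multiple of [eta0]. *)
pose C := segint (fun x => f x * derive1 eta0 x) 0 1 / segint eta0 0 1.
pose f1 x := f x + C * x.
have cf1 : continuous f1.
  move=> x; apply: cvgD; first exact: cf.
  by apply: cvgM; [exact: cvg_cst|exact: cvg_id].
have cid : continuous (fun x : R => x) by move=> x; exact: cvg_id.
have f1chi chi : compact_smooth chi ->
    segint (fun x => f1 x * derive1 chi x) 0 1 = 0.
  move=> chiT; have [F FT F'] := zero_mean _ chiT.
  set m := segint chi 0 1 in F'.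
  have F'' x : derive1 (derive1 F) x =
      derive1 chi x + - (m / segint eta0 0 1) * derive1 eta0 x.
    have -> : derive1 F = fun x => chi x + - (m / segint eta0 0 1) * eta0 x.
      exact/funext.
    have [dchi _] := smooth_derive chiT.1; have [deta _] := smooth_derive eta0T.1.
    have [_ dE] := is_derive_add (dchi x) (is_derive_scale (- (m / segint eta0 0 1)) (deta x)).
    by rewrite [LHS]derive1E dE.
  have := fphi _ FT.
  under eq_segint => x _ do rewrite F''.
  rewrite comb//; [|exact: compact_smooth_derive..] => fI.
  have xI : segint (fun x => x * derive1 chi x) 0 1 = - m.
    have cid' : ac (fun x : R => x) (fun=> 1).
      by apply: ac_derive => // x; exact: cvg_cst.
    have dT := compact_smooth_derive chiT.
    have [_ xcE] := acM cid' (compact_smooth_ac chiT) ler01.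
    move: xcE; rewrite segintD; [|exact: cfi|exact: cfi].
    rewrite -one -/m (compact_smooth_ends chiT).2 mulr0 mul0r subrr => /eqP.
    by rewrite eq_sym addrC addr_eq0 => /eqP.
  rewrite (eq_segint (g := fun x => f x * derive1 chi x + C * (x * derive1 chi x))); last first.
    by move=> x _; rewrite /f1; ring.
  have dT := compact_smooth_derive chiT.
  rewrite segintD; [|exact: cfi|by apply: segintegrableZ; exact: cfi].
  rewrite segintZ ?xI; last exact: cfi.
  move: fI; rewrite /C; move: (segint (fun x => f x * derive1 chi x) 0 1)
    (segint (fun x => f x * derive1 eta0 x) 0 1) (segint eta0 0 1) => I1 I2 E <-.
  by ring.
(* The same correction one order lower: [f1 - D] is orthogonal to [eta0]. *)
pose D := segint (fun x => f1 x * eta0 x) 0 1 / segint eta0 0 1.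
have f2 : forall x, 0 <= x <= 1 -> f1 x - D = 0.
  apply: (@ortho_test_eq0 (fun x => f1 x - D)).
    by move=> x; apply: cvgB; [exact: cf1|exact: cvg_cst].
  move=> phi phiT; have [F FT F'] := zero_mean _ phiT.
  have := f1chi _ FT; under eq_segint => x _ do rewrite F'.
  rewrite comb// => fI.
  rewrite (eq_segint (g := fun x => f1 x * phi x - D * phi x)); last by move=> x _; ring.
  rewrite segintB; [|exact: cfi|by apply: segintegrableZ; exact: ci].
  rewrite segintZ; last exact: ci.
  move: fI; rewrite /D; move: (segint (fun x => f1 x * phi x) 0 1)
    (segint phi 0 1) (segint (fun x => f1 x * eta0 x) 0 1) (segint eta0 0 1)
    => I1 I2 I3 E <-.
  by ring.
by exists D, (- C) => x /f2; rewrite /f1; lra.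
Qed.

End test_functions.

(** * Representatives of H^2 functions *)

Section sobolev_functions.
Context {R : realType}.
Implicit Types (f g u v p U phi : R -> R) (x a b : R).
Notation mu := (@lebesgue_measure R).

(** Composition with the 1-Lipschitz retraction of the line onto [0, 1]. *)
Lemma within_continuous_extension u : {within `[0, 1], continuous u} ->
  exists2 U, continuous U & forall x, 0 <= x <= 1 -> u x = U x.
Proof.
move=> cu; pose clamp x : R := Num.max 0 (Num.min x 1).
have clamp01 x : 0 <= clamp x <= 1.
  by rewrite /clamp le_max lexx/= ge_max ler01 ge_min lexx orbT.
have clampE x : 0 <= x <= 1 -> clamp x = x.
  by move=> /andP[x0 x1]; rewrite /clamp (min_idPl x1) (max_idPr x0).
have clampL x y : `|clamp x - clamp y| <= `|x - y|.
  rewrite ler_norml; have := ler_norm (x - y); have := ler_norm (- (x - y)).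
  rewrite normrN /clamp; case: (leP x 1) => x1; case: (leP y 1) => y1;
    rewrite ?(max_idPr ler01); case: (leP 0 x) => x0; case: (leP 0 y) => y0; lra.
exists (fun x => u (clamp x)); last by move=> x x01; rewrite clampE.
move=> x; apply/cvgrPdist_lt => e e0.
have xin : (`[0, 1]%classic : set R) (clamp x) by rewrite /= in_itv/= clamp01.
have /cvgrPdist_lt/(_ _ e0) near_u := cu (clamp x).
have : within `[0, 1] (nbhs (clamp x)) [set t | `|u (clamp x) - u t| < e].
  by rewrite (nbhs_subspace_in xin).
move=> /nbhs_ballP[d /= d0 hd]; exists d => //= y xy; apply: hd; last by rewrite /= in_itv/= clamp01.
exact: le_lt_trans (clampL _ _) xy.
Qed.

Lemma segintegrable_patch v : segintegrable v 0 1 ->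
  forall x y, segintegrable (v \_ `[0, 1]) x y.
Proof.
move=> iv x y.
have : mu.-integrable setT (EFin \o (v \_ `[0, 1])).
  rewrite -restrict_EFin; apply/integrable_restrict => //=; by rewrite setTI.
by apply: integrableS.
Qed.

Lemma segint_patch v g : segint (fun x => (v \_ `[0, 1]) x * g x) 0 1 =
  segint (fun x => v x * g x) 0 1.
Proof.
by apply: eq_segint => x x01; rewrite patchE mem_set//= in_itv.
Qed.

(** Let [W] be a second primitive of [v]. Two integrations by parts make [u - W] orthogonal to all
    second derivatives of test functions, hence affine. As the density is extended by zero, [p] is
    constant on each side of [0, 1], which later keeps the extended velocity nonzero. *)
Lemma weak_derivative2_repr u v : {within `[0, 1], continuous u} ->
  segintegrable v 0 1 -> is_weak_derivative 2 u v ->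
  exists U p, [/\ forall x, is_derive x 1 U (p x), ac p (v \_ `[0, 1]) &
    forall x, 0 <= x <= 1 -> u x = U x].
Proof.
move=> /within_continuous_extension[u' cu' uu'] iv wv.
have [P vP _] := ac_exists (segintegrable_patch iv).
have cP := ac_continuous vP.
have [W dW] := primitive_exists cP.
have aW := ac_derive cP dW; have cW := ac_continuous aW.
have [||A [B fAB]] := @ortho_test2_affine R (fun x => u' x - W x).
- by move=> x; apply: cvgB; [exact: cu'|exact: cW].
- move=> phi phiT.
  have phiT' := compact_smooth_derive phiT.
  have phiT'' := compact_smooth_derive phiT'.
  have cc g chi : continuous g -> compact_smooth chi ->
      segintegrable (fun x => g x * chi x) 0 1.
    move=> cg /compact_smooth_continuous cchi; apply: segintegrable_cont => x.
    by apply: cvgM; [exact: cg|exact: cchi].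
  have [_] := acM aW (compact_smooth_ac phiT') ler01.
  rewrite segintD; [|exact: cc|exact: cc].
  rewrite (compact_smooth_ends phiT').1 (compact_smooth_ends phiT').2 !mulr0 subrr => W1.
  have [_] := acM vP (compact_smooth_ac phiT) ler01.
  rewrite segintD; [| |exact: cc]; last first.
    apply: segintegrableM; last exact: (vP _ _ ler01).1.
    by apply: continuous_subspaceT; exact: compact_smooth_continuous.
  rewrite (compact_smooth_ends phiT).1 (compact_smooth_ends phiT).2 !mulr0 subrr.
  rewrite segint_patch => W2.
  have := wv phi (compact_smooth_test phiT).
  rewrite expr2 mulrNN !mulr1 mul1r -/(segint _ _ _) -/(segint _ _ _) => W3.
  rewrite (eq_segint (g := fun x => u' x * derive1 (derive1 phi) x -
    W x * derive1 (derive1 phi) x)); last by move=> x _; rewrite mulrBl.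
  rewrite segintB; [|exact: cc|exact: cc].
  rewrite -(eq_segint (f := fun x => u x * derive1 (derive1 phi) x)); last first.
    by move=> x /uu' ->.
  rewrite W3; move: W1 W2.
  move: (segint _ _ _) (segint _ _ _) (segint _ _ _) => a b c; lra.
exists (fun x => A + B * x + W x), (fun x => B + P x); split.
- move=> x; apply: is_derive_add => //.
  by have := is_derive_affine B A x; congr is_derive; apply/funext => t; rewrite addrC.
- move=> x y xy; have [i1 e1] := vP _ _ xy; split => //.
  by rewrite -e1; ring.
- by move=> x x01; have := fAB _ x01; rewrite uu'//; lra.
Qed.

Lemma sobolev2_repr u : {within `[0, 1], continuous u} -> sobolev 2 u ->
  let v := weak_derivative 2 u in L2 v /\
  exists U p, [/\ forall x, is_derive x 1 U (p x), ac p (v \_ `[0, 1]),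
    forall x, 0 <= x <= 1 -> u x = U x &
    forall x, 0 <= x <= 1 -> derivative01 u x = p x].
Proof.
move=> cu [_ /(_ 2%N (leqnn _)) ex_v] v.
have [vL vw] : L2 v /\ is_weak_derivative 2 u v.
  by case: ex_v => w wP; exact: (@getPex _ [set v | L2 v /\ is_weak_derivative 2 u v] (ex_intro _ w wP)).
split=> //; have [U [p [dU ap uU]]] := weak_derivative2_repr cu (L2_segintegrable vL) vw.
exists U, p; split=> // x x01; exact: derivative01_eq uU (dU x) x01.
Qed.

(** The endpoints lie outside the closed support, so [phi] vanishes near them. *)
Lemma test_function_ends phi c : test_function phi -> c = 0 \/ c = 1 ->
  phi c = 0 /\ derive1 phi c = 0.
Proof.
move=> [_ supp] c01.
have nc : ~ closure [set x | phi x != 0] c.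
  by move=> /supp /=; rewrite in_itv/=; case: c01 => ->; rewrite ltxx ?andbF.
have phi0 : \forall x \near c, cst (0 : R) x = phi x.
  have : nbhs c (~` closure [set x | phi x != 0]).
    by apply: open_nbhs_nbhs; split=> //; apply: closed_openC; exact: closed_closure.
  apply: filterS => x /= xc; apply/esym/eqP/negPn/negP => phix; apply: xc.
  exact: subset_closure.
split; first by have := nbhs_singleton phi0.
by rewrite derive1E -(near_eq_derive _ phi0) derive_cst.
Qed.

Lemma C2_sobolev U U1 U2 : (forall x, is_derive x 1 U (U1 x)) ->
  (forall x, is_derive x 1 U1 (U2 x)) -> continuous U2 -> sobolev 2 U.
Proof.
move=> dU dU1 cU2.
have cU1 := continuous_derive dU1; have cU := continuous_derive dU.
have L2c g : continuous g -> L2 g by move=> cg; apply: continuous_L2; exact: continuous_subspaceT.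
have aU := ac_derive cU1 dU; have aU1 := ac_derive cU2 dU1.
split; first exact: L2c.
have parts g g' phi phi' : continuous g' -> continuous phi' -> ac g g' -> ac phi phi' ->
    phi 0 = 0 -> phi 1 = 0 ->
    segint (fun x => g x * phi' x) 0 1 = - segint (fun x => g' x * phi x) 0 1.
  move=> cg' cphi' ag aphi p0 p1.
  have cg := ac_continuous ag; have cphi := ac_continuous aphi.
  have [_] := acM ag aphi ler01; rewrite p0 p1 !mulr0 subrr segintD.
  + by move=> /eqP; rewrite eq_sym addrC addr_eq0 => /eqP.
  + by apply: segintegrable_cont => x; apply: cvgM; [exact: cg'|exact: cphi].
  + by apply: segintegrable_cont => x; apply: cvgM; [exact: cg|exact: cphi'].
have test_ac phi n : test_function phi ->
    ac (derive1n n phi) (derive1n n.+1 phi) /\ continuous (derive1n n phi).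
  move=> [dphi _].
  have D m x : is_derive x 1 (derive1n m phi) (derive1n m.+1 phi x).
    by rewrite derive1nS derive1E; apply/derivableP; exact: dphi.
  split; last exact: continuous_derive (D n).
  by apply: ac_derive => //; exact: continuous_derive (D n.+1).
case=> [|[|[|//]]] _.
- by exists U; split=> [|phi _]; [exact: L2c|rewrite expr0 mul1r].
- exists U1; split=> [|phi phiT]; first exact: L2c.
  have [p0 _] := test_function_ends phiT (or_introl erefl).
  have [p1 _] := test_function_ends phiT (or_intror erefl).
  rewrite expr1 mulN1r; apply: (parts _ _ _ _ cU1 _ aU _ p0 p1).
    exact: (test_ac phi 1%N phiT).2.
  exact: (test_ac phi 0%N phiT).1.
- exists U2; split=> [|phi phiT]; first exact: L2c.
  have [p0 p0'] := test_function_ends phiT (or_introl erefl).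
  have [p1 p1'] := test_function_ends phiT (or_intror erefl).
  rewrite expr2 mulrNN !mulr1 mul1r.
  transitivity (- segint (fun x => U1 x * derive1n 1 phi x) 0 1).
    apply: (parts _ _ _ _ cU1 _ aU _ p0' p1').
      exact: (test_ac phi 2%N phiT).2.
    exact: (test_ac phi 1%N phiT).1.
  rewrite (parts _ _ _ _ cU2 _ aU1 (test_ac phi 0%N phiT).1 p0 p1) ?opprK//.
  exact: (test_ac phi 1%N phiT).2.
Qed.

(** [weak_derivative] picks an arbitrary representative. That choice and [U2] are densities of
    functions which agree on [0, 1] with the classical derivative of [U], so they agree almost
    everywhere. *)
Lemma weak_derivative2_ae U U1 U2 : (forall x, is_derive x 1 U (U1 x)) ->
  (forall x, is_derive x 1 U1 (U2 x)) -> continuous U2 ->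
  {ae mu, forall x, x \in `]0, 1[ -> weak_derivative 2 U x = U2 x}.
Proof.
move=> dU dU1 cU2.
have cU : {within `[0, 1], continuous U}.
  by apply: continuous_subspaceT; exact: continuous_derive dU.
have [vL [V [p [dV ap UV Up]]]] := sobolev2_repr cU (C2_sobolev dU dU1 cU2).
have pU1 x : 0 <= x <= 1 -> p x = U1 x.
  by move=> x01; rewrite -Up//; apply: (@derivative01_eq _ U U).
have := ac_uniq_ae (acB ap (ac_derive cU2 dU1)).
have pU1B x : 0 <= x <= 1 -> p x - U1 x = p 0 - U1 0.
  by move=> x01; rewrite !pU1 ?subrr// lexx ler01.
move=> /(_ pU1B); apply: filterS; first exact: (ae_filter_ringOfSetsType mu).
move=> x /= H x01; have /eqP := H x01; rewrite subr_eq0 patchE mem_set.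
  by move=> /eqP.
exact: subset_itv_oo_cc.
Qed.

End sobolev_functions.

(** * The tangent angle *)

Section polar_angle.
Context {R : realType}.
Implicit Types (p z a d th w f g : R -> R) (x y : R).
Notation mu := (@lebesgue_measure R).

Lemma ac_patch_const p a x y : ac p (a \_ `[0, 1]) -> x <= y ->
  (y <= 0 \/ 1 <= x) -> p y = p x.
Proof.
move=> ap xy xy01; have [iP eP] := ap _ _ xy; apply/eqP; rewrite -subr_eq0 eP.
rewrite (eq_segint_oo (g := fun=> 0))//; first by rewrite segint_cst// mul0r.
  by apply: segintegrable_cont; exact: cst_continuous.
move=> t xty; rewrite patchE memNset//= in_itv/=.
by case: xy01; lra.
Qed.

(* The argument of [p + i z] is the integral of the imaginary part of its
   logarithmic derivative; the integral of the real part gives the modulus. *)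
Lemma ac_polar p z a d : ac p a -> ac z d -> (forall x, 0 < p x ^+ 2 + z x ^+ 2) ->
  exists th, [/\ ac th (fun x => (p x * d x - z x * a x) / (p x ^+ 2 + z x ^+ 2)),
    forall x, 0 <= x ->
      Num.sqrt (p 0 ^+ 2 + z 0 ^+ 2) * Num.sqrt (p x ^+ 2 + z x ^+ 2) * cos (th x) =
      p 0 * p x + z 0 * z x &
    forall x, 0 <= x ->
      Num.sqrt (p 0 ^+ 2 + z 0 ^+ 2) * Num.sqrt (p x ^+ 2 + z x ^+ 2) * sin (th x) =
      p 0 * z x - z 0 * p x].
Proof.
move=> ap az v2_gt0; pose v2 x := p x ^+ 2 + z x ^+ 2.
have v2_neq0 x : v2 x != 0 by rewrite gt_eqF// v2_gt0.
have cp := ac_continuous ap; have cz := ac_continuous az.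
have cv2 : continuous v2.
  move=> x; apply: cvgD.
    by rewrite expr2; apply: cvgM; exact: cp.
  by rewrite expr2; apply: cvgM; exact: cz.
have cq g : continuous g -> continuous (fun x => g x / v2 x).
  by move=> cg x; apply: cvgM; [exact: cg|apply: cvgV; [exact: v2_neq0|exact: cv2]].
have iq f g x y : (forall x y, x <= y -> segintegrable f x y) -> continuous g ->
    segintegrable (fun x => f x * (g x / v2 x)) x y.
  move=> fi cg; have [xy|yx] := leP x y; last first.
    by rewrite /segintegrable set_itv_ge ?integrable_set0// -leNgt bnd_simp.
  apply: segintegrableM (fi _ _ xy); apply: continuous_subspaceT; exact: cq.
have ia x y : x <= y -> segintegrable a x y by move=> xy; exact: (ap _ _ xy).1.
have id x y : x <= y -> segintegrable d x y by move=> xy; exact: (az _ _ xy).1.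
pose w x := (p x * d x - z x * a x) / v2 x.
pose l x := (p x * a x + z x * d x) / v2 x.
have iw x y : segintegrable w x y.
  apply: eq_segintegrable (segintegrableB (iq d p x y id cp) (iq a z x y ia cz)).
  by move=> t _; rewrite /w; ring.
have il x y : segintegrable l x y.
  apply: eq_segintegrable (segintegrableD (iq a p x y ia cp) (iq d z x y id cz)).
  by move=> t _; rewrite /l; ring.
(* Since [th 0 = 0], the angle is measured from the initial direction. *)
have [th ath th0] := ac_exists iw; have [al aal al0] := ac_exists il.
have csinN : continuous (fun x : R => - sin x).
  by move=> x; apply: cvgN; exact: continuous_sin.
have acos_ := ac_comp ath csinN (@is_derive_cos R).
have asin_ := ac_comp ath (@continuous_cos R) (@is_derive_sin R).
have aexp : ac (fun x => expR (- al x)) (fun x => - l x * expR (- al x)).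
  have al' : ac (fun x => - al x) (fun x => - l x).
    have := acZ (-1) aal; rewrite (_ : (fun x => -1 * al x) = fun x => - al x).
      by apply: ac_eq => x; rewrite mulN1r.
    by apply/funext => x; rewrite mulN1r.
  exact: ac_comp al' (@continuous_expR R) (@is_derive_expR R).
(* [aX] and [aY] concern the real and imaginary parts of [(p + i z) exp (- (al + i th))]; both
   densities vanish, so this number is constant. *)
have aX := acM aexp (acD (acM ap acos_) (acM az asin_)).
have aY := acM aexp (acB (acM az acos_) (acM ap asin_)).
have X0 x : 0 <= x -> expR (- al x) * (p x * cos (th x) + z x * sin (th x)) = p 0.
  move=> x0; have := ac0_cst aX x0; rewrite /= th0 al0 oppr0 expR0 cos0 sin0.
  rewrite mulr1 mulr0 addr0 mul1r; apply => t _.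
  rewrite /= /w /l; have := v2_neq0 t; rewrite /v2 => v20; field; exact: v20.
have Y0 x : 0 <= x -> expR (- al x) * (z x * cos (th x) - p x * sin (th x)) = z 0.
  move=> x0; have := ac0_cst aY x0; rewrite /= th0 al0 oppr0 expR0 cos0 sin0.
  rewrite mulr1 mulr0 subr0 mul1r; apply => t _.
  rewrite /= /w /l; have := v2_neq0 t; rewrite /v2 => v20; field; exact: v20.
have vE x : 0 <= x -> Num.sqrt (v2 0) = expR (- al x) * Num.sqrt (v2 x).
  move=> x0; have -> : v2 0 = (expR (- al x)) ^+ 2 * v2 x.
    rewrite /v2 -(X0 x x0) -(Y0 x x0); have cs := cos2Dsin2 (th x).
    transitivity (expR (- al x) ^+ 2 * (p x ^+ 2 + z x ^+ 2) * (cos (th x) ^+ 2 + sin (th x) ^+ 2)).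
      by ring.
    by rewrite cs mulr1.
  by rewrite sqrtrM ?sqr_ge0// sqrtr_sqr ger0_norm// expR_ge0.
have vv x : Num.sqrt (v2 x) * Num.sqrt (v2 x) = v2 x by rewrite -expr2 sqr_sqrtr// ltW// v2_gt0.
exists th; split => // x x0; rewrite -/(v2 0) -/(v2 x) (vE x x0) -[_ * _ * Num.sqrt _]mulrA vv.
  by rewrite -(X0 x x0) -(Y0 x x0) /v2; ring.
by rewrite -(X0 x x0) -(Y0 x x0) /v2; ring.
Qed.

End polar_angle.

(** * The lower bound *)

Section elliptic_integrals.
Context {R : realType}.
Implicit Types (x y s t r : R).

(* In terms of the complete elliptic integrals of parameter [y] = k^2,
   [ellK y] = 2 K / pi and [ellJ y] = 2 (2 E - K) / pi. *)
Definition delta y t : R := Num.sqrt (1 - y * cos (pi * t) ^+ 2).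

Definition ellK y : R := segint (fun t => (delta y t)^-1) 0 1.

Definition ellJ y : R :=
  segint (fun t => (1 - 2 * y * cos (pi * t) ^+ 2) / delta y t) 0 1.

Lemma cospi2_le1 t : cos (pi * t) ^+ 2 <= 1.
Proof. by have := cos2Dsin2 (pi * t); have := sqr_ge0 (sin (pi * t)); lra. Qed.

Lemma delta_arg_gt0 y t : 0 <= y < 1 -> 0 < 1 - y * cos (pi * t) ^+ 2.
Proof. by have := cospi2_le1 t; have := sqr_ge0 (cos (pi * t)); nra. Qed.

Lemma delta_gt0 y t : 0 <= y < 1 -> 0 < delta y t.
Proof. by move=> y01; rewrite sqrtr_gt0 delta_arg_gt0. Qed.

Lemma delta_sqr y t : 0 <= y < 1 -> delta y t ^+ 2 = 1 - y * cos (pi * t) ^+ 2.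
Proof. by move=> y01; rewrite sqr_sqrtr// ltW// delta_arg_gt0. Qed.

Lemma is_derive_cospi t :
  is_derive t 1 (fun t => cos (pi * t)) (- (pi * sin (pi * t))).
Proof.
have dp := is_derive_scale pi (is_derive_id t (1 : R)).
have := is_derive_circ (f := cos) (is_derive_cos (pi * t)) dp.
by move=> /is_derive_eq; apply; ring.
Qed.

Lemma is_derive_sinpi t :
  is_derive t 1 (fun t => sin (pi * t)) (pi * cos (pi * t)).
Proof.
have dp := is_derive_scale pi (is_derive_id t (1 : R)).
have := is_derive_circ (f := sin) (is_derive_sin (pi * t)) dp.
by move=> /is_derive_eq; apply; ring.
Qed.

Lemma is_derive_delta y t : 0 <= y < 1 -> is_derive t 1 (delta y)
  (y * pi * cos (pi * t) * sin (pi * t) / delta y t).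
Proof.
move=> y01; have D0 := delta_gt0 t y01.
have dC2 := is_derive_mul (is_derive_cospi t) (is_derive_cospi t).
have := is_derive_sub (is_derive_cst (1 : R) t 1) (is_derive_scale y dC2).
have -> : (fun t => cst 1 t - y * (cos (pi * t) * cos (pi * t))) =
    (fun t => 1 - y * cos (pi * t) ^+ 2) by apply/funext => r; rewrite expr2.
move=> d1; have := @is_derive_sqrt R (fun t => 1 - y * cos (pi * t) ^+ 2) t _
  (delta_arg_gt0 t y01) d1.
move=> /is_derive_eq; apply.
rewrite -/(delta y t); have := lt0r_neq0 D0 => D0'; field; exact: D0'.
Qed.

Lemma continuous_delta y : 0 <= y < 1 -> continuous (delta y).
Proof. by move=> y01; apply: continuous_derive => t; exact: is_derive_delta. Qed.

Lemma continuous_cospi : continuous (fun t : R => cos (pi * t)).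
Proof. exact: continuous_derive is_derive_cospi. Qed.

Lemma continuous_sinpi : continuous (fun t : R => sin (pi * t)).
Proof. exact: continuous_derive is_derive_sinpi. Qed.

Lemma continuous_div_delta y (g : R -> R) : 0 <= y < 1 -> continuous g ->
  continuous (fun t => g t / delta y t).
Proof.
move=> y01 cg t; apply: cvgM; first exact: cg.
by apply: cvgV; [rewrite lt0r_neq0// delta_gt0|exact: continuous_delta].
Qed.

(* Convexity of [x / sqrt (1 - x s)] in [x], stated by tangents. *)
Lemma modulus_tangent x y s B : 0 <= s -> 0 <= x -> x * s < 1 -> y * s < 1 ->
  B = Num.sqrt (1 - y * s) ->
  y / B + (x - y) * (B^-1 + y * s / (2 * B ^+ 3)) <= x / Num.sqrt (1 - x * s).
Proof.
move=> s0 x0 xs ys BE; set A := Num.sqrt _.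
have A2 : A ^+ 2 = 1 - x * s by rewrite sqr_sqrtr//; lra.
have B2 : B ^+ 2 = 1 - y * s by rewrite BE sqr_sqrtr//; lra.
have A0 : 0 < A by rewrite sqrtr_gt0; lra.
have B0 : 0 < B by rewrite BE sqrtr_gt0; lra.
(* The tangent at [B^2] to the convex function [1 / sqrt q], taken at [q = A^2]. After
   multiplication by [x] the remaining gap is [s (x - y)^2 / (2 B^3)]. *)
have AB : B^-1 + (B ^+ 2 - A ^+ 2) / (2 * B ^+ 3) <= A^-1.
  rewrite -subr_ge0.
  have -> : A^-1 - (B^-1 + (B ^+ 2 - A ^+ 2) / (2 * B ^+ 3)) =
      (A - B) ^+ 2 * (A + 2 * B) / (2 * A * B ^+ 3).
    by field; rewrite !lt0r_neq0.
  apply: divr_ge0; first by apply: mulr_ge0; [exact: sqr_ge0|lra].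
  by apply: mulr_ge0; [apply: mulr_ge0; lra|apply: exprn_ge0; exact: ltW].
apply: le_trans (ler_wpM2l x0 AB).
rewrite -subr_ge0; have -> : x * (B^-1 + (B ^+ 2 - A ^+ 2) / (2 * B ^+ 3)) -
    (y / B + (x - y) * (B^-1 + y * s / (2 * B ^+ 3))) = s * (x - y) ^+ 2 / (2 * B ^+ 3).
  by rewrite A2 B2; field; rewrite lt0r_neq0.
apply: divr_ge0; first by apply: mulr_ge0 => //; exact: sqr_ge0.
by apply: mulr_ge0; [lra|apply: exprn_ge0; exact: ltW].
Qed.

Lemma ellK_ge0 y : 0 <= y < 1 -> 0 <= ellK y.
Proof. by move=> y01; apply: segint_ge0 => t _; rewrite invr_ge0 ltW// delta_gt0. Qed.

(** [y sin^2] is [(2 y - 1) / 2] plus half the numerator of [ellJ]. This serves both the lower bound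
    and the energy of the optimal curve. *)
Lemma segint_sin2_delta y : 0 <= y < 1 -> ellJ y = 0 ->
  segint (fun t => y * sin (pi * t) ^+ 2 / delta y t) 0 1 = (2 * y - 1) / 2 * ellK y.
Proof.
move=> y01 J0.
have i1 : segintegrable (fun t => (delta y t)^-1) 0 1.
  apply: eq_segintegrable (segintegrable_cont _ _ (continuous_div_delta y01 (@cst_continuous _ _ (1 : R)))).
  by move=> t _; rewrite mul1r.
have iJ : segintegrable (fun t => (1 - 2 * y * cos (pi * t) ^+ 2) / delta y t) 0 1.
  apply: segintegrable_cont; apply: continuous_div_delta => // t.
  apply: cvgB; first exact: cvg_cst.
  apply: cvgM; first exact: cvg_cst.
  by rewrite expr2; apply: cvgM; exact: continuous_cospi.
transitivity ((2 * y - 1) / 2 * ellK y + 2^-1 * ellJ y); last by rewrite J0 mulr0 addr0.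
rewrite -!segintZ// -segintD; [|exact: segintegrableZ..].
apply: eq_segint => t _; rewrite sin2cos2.
have := lt0r_neq0 (delta_gt0 t y01) => D0; field; exact: D0.
Qed.

(* The left-hand side minorizes, by AM-GM, the tangent line at [y] of the convex
   function [x |-> x * int sin^2 (pi t) / delta x t], whose slope is [ellK y / 2]:
   the derivative of the integrand is [1 / (2 delta y)] up to the derivative of
   a multiple of [cos (pi t) * sin (pi t) / delta y t], which vanishes at both
   ends. *)
Lemma elliptic_arc_bound x y (F th : R -> R) :
  1 / 2 < x <= 1 -> 1 / 2 < y < 1 -> ellJ y = 0 ->
  (forall r, is_derive r 1 F (Num.sqrt (1 + cos r / (2 * x - 1)))) ->
  {within `[0, 1], continuous th} ->
  (forall t, 0 < t < 1 -> is_derive t 1 th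
     (2 * pi * Num.sqrt x * sin (pi * t) / Num.sqrt (1 - x * cos (pi * t) ^+ 2))) ->
  (forall t, 0 < t < 1 -> cos (th t) = 1 - 2 * x * cos (pi * t) ^+ 2) ->
  pi * Num.sqrt (2 * (2 * y - 1)) * ellK y <= F (th 1) - F (th 0).
Proof.
move=> x12 y12 J0 dF cth dth costh.
have y01 : 0 <= y < 1 by lra.
have cF := continuous_derive dF.
pose m := Num.sqrt (2 / (2 * x - 1)).
have m2 : m ^+ 2 = 2 / (2 * x - 1) by rewrite sqr_sqrtr// divr_ge0//; lra.
have m0 : 0 <= m by exact: sqrtr_ge0.
pose C t := cos (pi * t); pose S t := sin (pi * t); pose D := delta y.
have D0 t : 0 < D t by exact: delta_gt0.
have cK : continuous (fun t => 1 / D t).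
  by apply: continuous_div_delta => //; exact: cst_continuous.
have [Kf dK] := primitive_exists cK.
have cQ : continuous (fun t => y * S t ^+ 2 / D t).
  apply: continuous_div_delta => // t; apply: cvgM; first exact: cvg_cst.
  by rewrite expr2; apply: cvgM; exact: continuous_sinpi.
have [Qf dQ] := primitive_exists cQ.
pose r t := - (2 * pi)^-1 * (C t * S t / D t).
have pi0 : pi != 0 :> R by rewrite gt_eqF// pi_gt0.
have CS t : C t ^+ 2 + S t ^+ 2 = 1 by exact: cos2Dsin2.
have dr t : is_derive t 1 r
    (2^-1 * ((S t ^+ 2 - C t ^+ 2) / D t + y * C t ^+ 2 * S t ^+ 2 / D t ^+ 3)).
  have Dn := lt0r_neq0 (D0 t).
  have dCS := is_derive_mul (is_derive_cospi t) (is_derive_sinpi t).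
  have dCSD := is_derive_mul dCS (is_derive_inv Dn (is_derive_delta t y01)).
  have := is_derive_scale (- (2 * pi)^-1) dCSD; move=> /is_derive_eq; apply.
  rewrite -/(C t) -/(S t) -/(D t); move: Dn pi0.
  move: (C t) (S t) (D t) (@pi R) => c s e P e0 P0; field.
  by rewrite e0 P0.
pose T t := Qf t + (x - y) * (2^-1 * Kf t + r t).
pose T' t := S t ^+ 2 * (y / D t + (x - y) * ((D t)^-1 + y * C t ^+ 2 / (2 * D t ^+ 3))).
have dT t : is_derive t 1 T (T' t).
  have Dn := lt0r_neq0 (D0 t).
  have := is_derive_add (dQ t) (is_derive_scale (x - y)
    (is_derive_add (is_derive_scale 2^-1 (dK t)) (dr t))).
  move=> /is_derive_eq; apply; rewrite /T'.
  have -> : C t ^+ 2 = 1 - S t ^+ 2 by rewrite -(CS t) addrK.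
  by field.
have T10 : T 1 - T 0 = (x + y - 1) / 2 * ellK y.
  have aK : Kf 1 - Kf 0 = ellK y.
    rewrite (ac_derive cK dK ler01).2.
    by apply: eq_segint => t _; rewrite div1r.
  have aQ : Qf 1 - Qf 0 = (2 * y - 1) / 2 * ellK y.
    by rewrite (ac_derive cQ dQ ler01).2 -segint_sin2_delta.
  have r1 : r 1 = 0 by rewrite /r /S mulr1 sinpi mulr0 mul0r mulr0.
  have r0 : r 0 = 0 by rewrite /r /S mulr0 sin0 mulr0 mul0r mulr0.
  transitivity (Qf 1 - Qf 0 + (x - y) * (2^-1 * (Kf 1 - Kf 0) + (r 1 - r 0))).
    by rewrite /T; ring.
  by rewrite aK aQ r1 r0; field.
(* Monotonicity of [G] on the closed segment needs its derivative only inside: when [x = 1], the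
   formula for [th'] is the quotient 0 / 0 at both ends. *)
pose G t := F (th t) - 2 * pi * m * T t.
have dG t : 0 < t < 1 -> is_derive t 1 G
    (2 * pi * m * (x * S t ^+ 2 / Num.sqrt (1 - x * C t ^+ 2) - T' t)).
  move=> t01.
  have := is_derive_sub (is_derive_circ (dF (th t)) (dth _ t01))
    (is_derive_scale (2 * pi * m) (dT t)).
  move=> /is_derive_eq; apply; rewrite costh//.
  have -> : 1 + (1 - 2 * x * cos (pi * t) ^+ 2) / (2 * x - 1) = m ^+ 2 * x * S t ^+ 2.
    rewrite m2; have -> : S t ^+ 2 = 1 - cos (pi * t) ^+ 2 by exact: sin2cos2.
    by field; lra.
  have x0 : 0 <= x by lra.
  have S0 : 0 <= S t.
    by apply: sin_ge0_pi; have := @pi_gt0 R; nra.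
  rewrite sqrtrM; last by rewrite mulr_ge0// sqr_ge0.
  rewrite sqrtrM ?sqr_ge0// !sqrtr_sqr (ger0_norm m0) (ger0_norm S0).
  rewrite -/(C t) -/(S t); have xE : x = Num.sqrt x * Num.sqrt x by rewrite -expr2 sqr_sqrtr.
  set W := Num.sqrt (1 - _); set V := T' t.
  by rewrite [X in _ = _ * (X * _ / _ - _)]xE; ring.
have Gle : G 0 <= G 1.
  apply: (@ger0_derive1_le_cc R G 0 1) => //; rewrite ?in_itv/= ?lexx ?ler01//.
  - by move=> t; rewrite in_itv/= => /dG [].
  - move=> t; rewrite in_itv/= => t01; rewrite derive1E; have [_ ->] := dG _ t01.
    have S0 : 0 < S t by apply: sin_gt0_pi; have := @pi_gt0 R; nra.
    have C1 : C t ^+ 2 < 1 by have := CS t; have := exprn_gt0 2 S0; lra.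
    have C0 := sqr_ge0 (C t).
    rewrite mulr_ge0// ?mulr_ge0 ?pi_ge0// subr_ge0 /T' -[leRHS]mulrA [leRHS]mulrCA.
    rewrite ler_wpM2l ?sqr_ge0//.
    by apply: modulus_tangent => //; [lra|nra..].
  - move=> t; apply: cvgB.
      apply: cvg_comp; [exact: cth|exact: cF].
    apply: cvgM; first exact: cvg_cst.
    by apply: continuous_subspaceT; exact: continuous_derive dT.
have : 2 * pi * m * (T 1 - T 0) <= F (th 1) - F (th 0) by rewrite /G in Gle; lra.
apply: le_trans; rewrite T10.
have -> : 2 * pi * m * ((x + y - 1) / 2 * ellK y) = pi * (m * (x + y - 1)) * ellK y by field.
rewrite ler_wpM2r ?ellK_ge0// ler_wpM2l ?pi_ge0//.
have xy0 : 0 <= x + y - 1 by lra.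
(* With [a = 2 x - 1] and [b = 2 y - 1], what remains is [((a + b) / 2)^2 >= a b]. *)
rewrite -(ger0_norm (mulr_ge0 m0 xy0)) -sqrtr_sqr ler_wsqrtr// exprMn m2.
rewrite mulrAC ler_pdivlMr; last by lra.
by have := sqr_ge0 (x - y); nra.
Qed.

End elliptic_integrals.

Section energy_bound.
Context {R : realType}.
Implicit Types (x y s t r b : R) (th v w F : R -> R).

Lemma le_cos_norm b t : `|t| <= b -> b <= pi -> cos b <= cos t :> R.
Proof.
move=> tb bpi; rewrite -(cos_norm t) leNgt ltr_cos ?in_itv/= -?leNgt//.
  by rewrite bpi (le_trans _ tb).
by rewrite normr_ge0 (le_trans tb).
Qed.

(** The arc is parametrized by [sin (th / 2) = - k cos (pi t)] with [k = sin (b / 2)], which runs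
    from [-b] to [b]; [k^2 > 1 / 2] because [cos b = 1 - 2 k^2] is negative. *)
Lemma pendulum_arc_bound b y F : pi / 2 < b <= pi -> 1 / 2 < y < 1 -> ellJ y = 0 ->
  (forall r, is_derive r 1 F (Num.sqrt (1 - cos r / cos b))) ->
  pi * Num.sqrt (2 * (2 * y - 1)) * ellK y <= F b - F (- b).
Proof.
move=> /andP[b2 bpi] y12 J0 dF; have pi0 := @pi_gt0 R.
pose k := sin (b / 2); have k0 : 0 < k by apply: sin_gt0_pi; lra.
pose x := k ^+ 2; have sx : Num.sqrt x = k by rewrite sqrtr_sqr ger0_norm// ltW.
have cosb : cos b = 1 - 2 * x.
  have -> : b = (b / 2) *+ 2 by rewrite -mulr_natr divfK.
  by rewrite cos_mulr2n cos2sin2 -mulr_natl mulrBr mulr1 /x /k; ring.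
have cosb0 : cos b < 0.
  have := @cos_pihalf R => <-; rewrite ltr_cos// in_itv/=; lra.
have x1 : x <= 1 by rewrite /x sin2cos2; have := sqr_ge0 (cos (b / 2)); lra.
have x12 : 1 / 2 < x <= 1 by rewrite x1 andbT; lra.
have dF' r : is_derive r 1 F (Num.sqrt (1 + cos r / (2 * x - 1))).
  have -> : 1 + cos r / (2 * x - 1) = 1 - cos r / cos b by rewrite cosb; field; lra.
  exact: dF.
(* At [b = pi] the substitution would use [asin] up to -1 and 1, where it is not differentiable; it
   then reduces to a linear one. *)
have [bE|bne] := eqVneq b pi.
  have x_1 : x = 1 by rewrite /x /k bE sin_pihalf expr1n.
  have dth t : is_derive t 1 (fun t => 2 * pi * t + - pi) (2 * pi) by exact: is_derive_affine.
  have := @elliptic_arc_bound R x y F (fun t => 2 * pi * t + - pi) x12 y12 J0 dF'.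
  rewrite mulr1 mulr0 add0r bE (_ : 2 * pi + - pi = pi); last by ring.
  apply.
  - by apply: continuous_subspaceT; exact: continuous_derive dth.
  - move=> t t01; apply: (is_derive_eq (dth t)); rewrite x_1 sqrtr1 mulr1 mul1r -sin2cos2.
    have S0 : 0 < sin (pi * t) by apply: sin_gt0_pi; nra.
    by rewrite sqrtr_sqr ger0_norm ?ltW// mulfK// gt_eqF.
  - move=> t _; rewrite cosB cospi sinpi mulr0 addr0 x_1.
    have -> : 2 * pi * t = (pi * t) *+ 2 by rewrite mulr2n; ring.
    by rewrite cos_mulr2n mulr2n; ring.
have b_lt : b < pi by rewrite lt_neqAle bne.
have k1 : k < 1.
  by rewrite /k -[ltRHS](@sin_pihalf R) ltr_sin// ?in_itv/=; lra.
pose th t := -2 * asin (k * cos (pi * t)).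
have dth t : `|k * cos (pi * t)| < 1 -> is_derive t 1 th
    (2 * pi * Num.sqrt x * sin (pi * t) / Num.sqrt (1 - x * cos (pi * t) ^+ 2)).
  rewrite ltr_norml => kC.
  have := is_derive_scale (-2) (@is_derive_circ R asin (fun t => k * cos (pi * t)) t _ _
    (is_derive1_asin kC) (is_derive_scale k (is_derive_cospi t))).
  by move=> /is_derive_eq; apply; rewrite exprMn -/x sx; ring.
have kC1 t : `|k * cos (pi * t)| < 1.
  by rewrite normrM gtr0_norm//; have := cos_max (pi * t); have := normr_ge0 (cos (pi * t)); nra.
have := @elliptic_arc_bound R x y F th x12 y12 J0 dF'.
have asink : asin k = b / 2 by rewrite /k sinK// in_itv/=; lra.
have asinNk : asin (- k) = - (b / 2) by rewrite /k -sinN sinK// in_itv/=; lra.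
have th1 : th 1 = b by rewrite /th mulr1 cospi mulrN1 asinNk; field.
have th0 : th 0 = - b by rewrite /th mulr0 cos0 mulr1 asink; field.
rewrite th1 th0; apply.
- by apply: continuous_subspaceT; apply: continuous_derive => t; exact: dth.
- by move=> t _; exact: dth.
- move=> t _; rewrite /th (_ : -2 * asin _ = - (asin (k * cos (pi * t)) *+ 2)); last first.
    by rewrite -mulr_natl; ring.
  rewrite cosN cos_mulr2n cos2sin2 asinK; last first.
    by rewrite in_itv/=; have := kC1 t; rewrite ltr_norml => /andP[/ltW-> /ltW->].
  by rewrite exprMn -/x -mulr_natl; ring.
Qed.

Lemma angle_energy_ge y th v w : 1 / 2 < y < 1 -> ellJ y = 0 ->
  ac th w -> continuous v -> (forall x, 0 < v x) ->
  segintegrable (fun x => w x ^+ 2 / v x + v x) 0 1 ->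
  segint (fun x => v x * cos (th x)) 0 1 = 0 ->
  segint (fun x => v x * sin (th x)) 0 1 = 0 ->
  2 * (pi * Num.sqrt (2 * (2 * y - 1)) * ellK y) <=
    segint (fun x => w x ^+ 2 / v x + v x) 0 1.
Proof.
move=> y12 J0 ath cv v0 iE vcos vsin; have pi0 := @pi_gt0 R.
have cth := ac_continuous ath.
have [x2 x2in thmax] := EVT_max ler01 (continuous_subspaceT cth).
have [x1 x1in thmin] := EVT_min ler01 (continuous_subspaceT cth).
rewrite !in_itv/= in x1in x2in.
pose m := (th x2 + th x1) / 2; pose b := (th x2 - th x1) / 2.
pose psi x := th x - m.
have apsi : ac psi w.
  by apply: (ac_eq _ (acB ath (ac_cst m))) => x; rewrite subr0.
have cpsi := ac_continuous apsi.
have psi1 : psi x1 = - b by rewrite /psi /m /b; field.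
have psi2 : psi x2 = b by rewrite /psi /m /b; field.
have psib x : 0 <= x <= 1 -> `|psi x| <= b.
  move=> x01; rewrite ler_norml /psi /m /b.
  by have := thmax x; have := thmin x; rewrite !in_itv/= => /(_ x01) + /(_ x01); lra.
have ccospsi : continuous (fun x => cos (psi x)).
  by move=> x; apply: continuous_comp; [exact: cpsi|exact: continuous_cos].
have cvcos : continuous (fun x => v x * cos (psi x)).
  by move=> x; apply: cvgM; [exact: cv|exact: ccospsi].
have vcospsi : segint (fun x => v x * cos (psi x)) 0 1 = 0.
  have ic f : continuous f -> segintegrable (fun x => v x * f (th x)) 0 1.
    move=> cf; apply: segintegrable_cont => x; apply: cvgM; first exact: cv.
    by apply: continuous_comp; [exact: cth|exact: cf].
  have icos := ic _ (@continuous_cos R); have isin := ic _ (@continuous_sin R).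
  rewrite (eq_segint (g := fun x => cos m * (v x * cos (th x)) + sin m * (v x * sin (th x)))).
    by rewrite segintD ?segintZ ?vcos ?vsin ?mulr0 ?addr0//; exact: segintegrableZ.
  by move=> x _; rewrite /psi cosB; ring.
have b0 : 0 <= b by apply: le_trans (psib x1 _) => //.
have b2 : pi / 2 < b.
  (* Otherwise [v cos psi] is nonnegative on [0, 1] and positive at a zero of [psi], against its
     zero integral. *)
  rewrite ltNge; apply/negP => b2.
  have [c c01 psic] : exists2 c, 0 <= c <= 1 & psi c = 0.
    have [x12|x21] := leP x1 x2.
    - have [||c c12 pc] := @IVT R psi x1 x2 0 x12; first exact: continuous_subspaceT.
        by rewrite psi1 psi2 ge_min le_max oppr_le0 b0 orbT.
      by exists c => //; move: c12; rewrite in_itv/=; lra.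
    - have [||c c12 pc] := @IVT R psi x2 x1 0 (ltW x21); first exact: continuous_subspaceT.
        by rewrite psi1 psi2 ge_min le_max oppr_le0 b0 orbT.
      by exists c => //; move: c12; rewrite in_itv/=; lra.
  have := @segint_gt0 R _ c cvcos; rewrite vcospsi ltxx => /(_ _ c01)H.
  have : false; last by [].
  apply: H.
    move=> x x01; apply: mulr_ge0; first exact: ltW.
    by apply: cos_ge0_pihalf; have := psib _ x01; rewrite ler_norml; lra.
  by rewrite psic cos0 mulr1.
(* The truncation keeps [1 - cos r / cos be] nonnegative on the range of [psi]: the least cosine on
   [-b, b] is [cos b] if [b <= pi] and -1 beyond. *)
pose be := Num.min b pi.
have be2 : pi / 2 < be <= pi.
  by rewrite lt_min b2 ge_min lexx orbT andbT/=; lra.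
have beb : be <= b by rewrite ge_min lexx.
have cosbe : cos be < 0.
  by rewrite -(@cos_pihalf R) ltr_cos ?in_itv/=; lra.
pose h r := Num.sqrt (1 - cos r / cos be).
have ch : continuous h.
  move=> r; apply: continuous_comp; last exact: sqrt_continuous.
  apply: cvgB; first exact: cvg_cst.
  by apply: cvgM; [exact: continuous_cos|exact: cvg_cst].
have [F dF] := primitive_exists ch.
have h2 x : 0 <= x <= 1 -> h (psi x) ^+ 2 = 1 - cos (psi x) / cos be.
  move=> x01; rewrite sqr_sqrtr// subr_ge0 ler_ndivrMr// mul1r.
  rewrite /be; case: (leP b pi) => bpi; first exact: le_cos_norm (psib _ x01) bpi.
  by rewrite cospi cos_geN1.
pose N x := w x ^+ 2 / v x + v x + - (cos be)^-1 * (v x * cos (psi x)).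
have iN : segintegrable N 0 1.
  by apply: segintegrableD => //; apply: segintegrableZ; exact: segintegrable_cont.
have NE : segint N 0 1 = segint (fun x => w x ^+ 2 / v x + v x) 0 1.
  rewrite segintD//; last by apply: segintegrableZ; exact: segintegrable_cont.
  by rewrite segintZ ?vcospsi ?mulr0 ?addr0//; exact: segintegrable_cont.
(* AM-GM as a completed square. The sign [e] allows for both directions in which the angle may run
   between its extrema; the two signs together give [N >= 0]. *)
have N2wh x e : 0 <= x <= 1 -> e ^+ 2 = 1 -> 2 * e * (w x * h (psi x)) <= N x.
  move=> x01 e1; rewrite -subr_ge0.
  have -> : N x - 2 * e * (w x * h (psi x)) = (w x - e * (v x * h (psi x))) ^+ 2 / v x.
    rewrite /N sqrrB !exprMn e1 h2//; field.
    by rewrite lt0r_neq0// lt_eqF.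
  by rewrite divr_ge0 ?sqr_ge0// ltW.
have N0 x : 0 <= x <= 1 -> 0 <= N x.
  move=> x01; have := N2wh x 1 x01 (expr1n _ _); have := N2wh x (-1) x01.
  by rewrite sqrrN expr1n => /(_ erefl); lra.
(* Only the piece between the two extrema is estimated; the rest of the integral of [N] is
   nonnegative. *)
have part a c e : 0 <= a -> a <= c -> c <= 1 -> e ^+ 2 = 1 ->
    2 * e * (F (psi c) - F (psi a)) <= segint N 0 1.
  move=> a0 acle c1 e1; have [iwh ->] := ac_comp apsi ch dF acle.
  have a1 := le_trans acle c1; have c0 := le_trans a0 acle.
  rewrite (segint_add a0 a1 iN) (segint_add acle c1 (segintegrable_sub a0 (lexx _) iN)).
  rewrite -segintZ//.
  have I1 : 0 <= segint N 0 a by apply: segint_ge0 => x xa; apply: N0; lra.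
  have I3 : 0 <= segint N c 1 by apply: segint_ge0 => x xa; apply: N0; lra.
  have : segint (fun x => 2 * e * (w x * h (psi x))) a c <= segint N a c.
    apply: le_segint; first exact: segintegrableZ.
      exact: segintegrable_sub iN.
    by move=> x xac; apply: N2wh => //; lra.
  by move=> I2; rewrite -[leLHS]add0r lerD// -[leLHS]addr0 lerD.
have Fmono r s : r <= s -> F r <= F s.
  move=> rs; rewrite -subr_ge0 (ac_derive ch dF rs).2.
  by apply: segint_ge0 => t _; exact: sqrtr_ge0.
have key : 2 * (F b - F (- b)) <= segint N 0 1.
  have [x12|x21] := leP x1 x2.
    have := part x1 x2 1; rewrite psi1 psi2 mulr1; apply; rewrite ?expr1n//; lra.
  have := part x2 x1 (-1); rewrite psi1 psi2.
  have -> : 2 * -1 * (F (- b) - F b) = 2 * (F b - F (- b)) by ring.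
  by apply; rewrite ?sqrrN ?expr1n//; lra.
rewrite -NE; apply: le_trans key.
have := pendulum_arc_bound be2 y12 J0 dF.
have := Fmono _ _ beb; have := Fmono (- b) (- be); rewrite lerN2 => /(_ beb); lra.
Qed.

End energy_bound.

(** * The minimizer *)

Section modulus.
Context {R : realType}.
Implicit Types (x y s t : R).
Notation mu := (@lebesgue_measure R).

Lemma sin_le_id x : 0 <= x -> sin x <= x.
Proof.
move=> x0; have d t : is_derive t 1 (fun t => t - sin t) (1 - cos t).
  exact: is_derive_sub.
have c : continuous (fun t : R => 1 - cos t).
  by move=> t; apply: cvgB; [exact: cvg_cst|exact: continuous_cos].
have := (ac_derive c d x0).2; rewrite sin0 !subr0 => xE.
by rewrite -subr_ge0 xE; apply: segint_ge0 => t _; rewrite subr_ge0 cos_le1.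
Qed.

(** The triple angle formula at [pi / 6] factors as [(s + 1) (2 s - 1)^2 = 0], so the sine there is
    1/2, and [sin t <= t]. *)
Lemma pi_ge3 : 3 <= pi :> R.
Proof.
have pi0 := @pi_gt0 R; pose s := sin (pi / 6 : R).
have s0 : 0 < s by apply: sin_gt0_pi; lra.
have s3 : 3 * s - 4 * s ^+ 3 = 1.
  transitivity (sin (pi / 6 *+ 2 + pi / 6) : R); last first.
    by rewrite -[RHS]sin_pihalf; congr sin; rewrite mulr2n; field.
  rewrite sinD sin_mulr2n cos_mulr2n -/s !mulr2n.
  have -> : s ^+ 3 = s * (1 - cos (pi / 6) ^+ 2) by rewrite -sin2cos2 -exprS.
  by ring.
have : (s + 1) * (2 * s - 1) ^+ 2 = 0 by have := s3; nra.
move=> /eqP; rewrite mulf_eq0 gt_eqF/=; last by lra.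
rewrite expf_eq0/= => /eqP sE.
have : s <= pi / 6 by apply: sin_le_id; lra.
by lra.
Qed.

(** At 1/2 the integrand is [sin^2 / delta], at least [sin^2] since [delta <= 1]. *)
Lemma ellJ_half_gt0 : 0 < ellJ (2^-1 : R).
Proof.
have y01 : 0 <= (2^-1 : R) < 1 by lra.
have S2 : continuous (fun t : R => sin (pi * t) ^+ 2).
  move=> t; apply: (@continuous_comp _ _ _ (fun t => sin (pi * t)) (fun r : R => r ^+ 2)).
    exact: continuous_sinpi.
  exact: exprn_continuous.
have C2 : continuous (fun t : R => 1 - 2 * 2^-1 * cos (pi * t) ^+ 2).
  move=> t; apply: cvgB; first exact: cvg_cst.
  apply: cvgM; first exact: cvg_cst.
  by rewrite expr2; apply: cvgM; exact: continuous_cospi.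
have : 0 < segint (fun t : R => sin (pi * t) ^+ 2) 0 1.
  apply: (@segint_gt0 _ _ 2^-1) => //; [by move=> t _; exact: sqr_ge0|lra|].
  by rewrite sin_pihalf expr1n.
move/lt_le_trans; apply; apply: le_segint.
- exact: segintegrable_cont.
- by apply: segintegrable_cont; exact: continuous_div_delta.
move=> t _; rewrite (divff (lt0r_neq0 (ltr0Sn R 1))) mul1r -sin2cos2.
have D0 := delta_gt0 t y01; have D2 := delta_sqr t y01.
rewrite ler_pdivlMr// ler_piMr ?sqr_ge0//.
rewrite -(@ler_pXn2r _ 2) ?nnegrE ?(ltW D0)// expr1n D2.
by have := sqr_ge0 (cos (pi * t)); lra.
Qed.

(** Here [y = 1 - e^2] with [e = 1 / 40], whence [delta <= sin + e]. The integrand is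
    [2 delta - 1 / delta], below the line [4 delta - 14 / 5]; with [pi >= 3] the integral is at most
    [8 / 3 + 1 / 10 - 14 / 5 = - 1 / 30]. *)
Lemma ellJ_lt0 : ellJ (1599 / 1600 : R) < 0.
Proof.
set y : R := 1599 / 1600; have y01 : 0 <= y < 1 by rewrite /y; lra.
pose e : R := 1 / 40.
have cS := @continuous_sinpi R.
have iS : segintegrable (fun t : R => sin (pi * t)) 0 1 by exact: segintegrable_cont.
have SI : segint (fun t : R => sin (pi * t)) 0 1 = 2 / pi.
  have d t : is_derive t 1 (fun t => - pi^-1 * cos (pi * t)) (sin (pi * t)).
    have := is_derive_scale (- pi^-1) (is_derive_cospi t).
    move=> /is_derive_eq; apply; rewrite mulrNN mulKf//.
    by rewrite gt_eqF// pi_gt0.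
  rewrite -(ac_derive cS d ler01).2 mulr1 mulr0 cospi cos0; ring.
pose G t : R := 4 * sin (pi * t) + (4 * e - 14 / 5).
have cG : continuous G.
  move=> t; apply: cvgD; last exact: cvg_cst.
  by apply: cvgM; [exact: cvg_cst|exact: cS].
apply: (@le_lt_trans _ _ (segint G 0 1)).
  apply: le_segint; last 1 first.
  - move=> t t01; have D0 := delta_gt0 t y01; have D2 := delta_sqr t y01.
    have S0 : 0 <= sin (pi * t) by apply: sin_ge0_pi; have := @pi_gt0 R; nra.
    have De : delta y t <= sin (pi * t) + e.
      rewrite -(@ler_pXn2r _ 2) ?nnegrE ?(ltW D0) ?addr_ge0 ?divr_ge0// D2.
      rewrite (_ : y = 1 - e ^+ 2); last by rewrite /y /e; field.
      have := cos2Dsin2 (pi * t); have := sqr_ge0 (sin (pi * t)).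
      have : 0 <= e * sin (pi * t) by rewrite mulr_ge0// /e divr_ge0.
      by have : e = 1 / 40 by []; nra.
    (* The tangent of slope 4 to [2 delta - 1 / delta] is [4 delta - 2 sqrt 2], and 14/5 is a
       rational number just below [2 sqrt 2]. *)
    apply: (@le_trans _ _ (4 * delta y t - 14 / 5)); last by rewrite /G; lra.
    rewrite ler_pdivrMr// (_ : 1 - 2 * y * _ = 2 * delta y t ^+ 2 - 1); last by rewrite D2; ring.
    by have := sqr_ge0 (delta y t - 7 / 10); nra.
  - apply: segintegrable_cont; apply: continuous_div_delta => // t.
    apply: cvgB; first exact: cvg_cst.
    apply: cvgM; first exact: cvg_cst.
    by rewrite expr2; apply: cvgM; exact: continuous_cospi.
  - exact: segintegrable_cont.
rewrite segintD; [|exact: segintegrableZ|by apply: segintegrable_cont; exact: cst_continuous].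
rewrite segintZ// SI segint_cst// subr0 mulr1.
have : 2 / pi <= 2 / 3 :> R.
  by rewrite ler_pM2l// lef_pV2 ?posrE ?pi_gt0// pi_ge3.
by rewrite /e; lra.
Qed.

(** Dominated convergence. The cut [b = 1999 / 2000] lies just beyond 1599/1600, and
    [delta >= sqrt (1 - b)] below it gives a constant majorant. *)
Lemma ellJ_continuous : {in `]0, (1999 / 2000)[, continuous (@ellJ R)}.
Proof.
pose b : R := 1999 / 2000; have b01 : 0 <= b < 1 by rewrite /b; lra.
pose f y t : R := (1 - 2 * y * cos (pi * t) ^+ 2) / delta y t.
have in01 y : (`]0, b[%classic : set R) y -> 0 <= y < 1.
  by rewrite /= in_itv/= /b; lra.
have H := @continuity_under_integral R _ _ mu f `[0, 1] (measurable_itv _) 0 b.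
have {}H := H _ _ (fun=> (Num.sqrt (1 - b))^-1) _ _.
move=> y y0b; apply: H.
- move=> z /in01 z01; apply: segintegrable_cont; apply: continuous_div_delta => // t.
  apply: cvgB; first exact: cvg_cst.
  apply: cvgM; first exact: cvg_cst.
  by rewrite expr2; apply: cvgM; exact: continuous_cospi.
- apply: aeW => t _ z /set_mem /in01 z01.
  apply: cvgM.
    apply: cvgB; first exact: cvg_cst.
    apply: cvgM; last exact: cvg_cst.
    by apply: cvgM; [exact: cvg_cst|exact: cvg_id].
  apply: cvgV; first by rewrite lt0r_neq0// delta_gt0.
  apply: (@continuous_comp _ _ _ (fun y => 1 - y * cos (pi * t) ^+ 2)); last exact: sqrt_continuous.
  apply: cvgB; first exact: cvg_cst.
  by apply: cvgM; [exact: cvg_id|exact: cvg_cst].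
- by apply: segintegrable_cont; exact: cst_continuous.
- move=> z zb; have z01 := in01 _ zb; apply: aeW => t _.
  rewrite /f normrM -[leRHS]mul1r; apply: ler_pM => //.
    have := cospi2_le1 t; have := sqr_ge0 (cos (pi * t)).
    by rewrite ler_norml; nra.
  rewrite normfV ger0_norm ?(ltW (delta_gt0 _ _))// lef_pV2 ?posrE ?delta_gt0 ?sqrtr_gt0//; last first.
    by rewrite subr_gt0; case/andP: b01.
  apply: ler_wsqrtr; move: zb; rewrite /= in_itv/=.
  by have := cospi2_le1 t; have := sqr_ge0 (cos (pi * t)); nra.
- by rewrite inE.
Qed.

Lemma ellJ_root : exists2 y : R, 1 / 2 < y < 1 & ellJ y = 0.
Proof.
pose a : R := 1599 / 1600.
have [|||y yab J0] := @IVT R (@ellJ R) 2^-1 a 0.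
- by rewrite /a; lra.
- apply: continuous_in_subspaceT => y /set_mem; rewrite /= in_itv/= /a => y_in.
  by apply: ellJ_continuous; rewrite in_itv/=; lra.
- by rewrite ge_min le_max (ltW ellJ_half_gt0) (ltW ellJ_lt0) orbT.
exists y => //; move: yab; rewrite in_itv/= /a => /andP[y1 y2].
have y_neq : y != 2^-1.
  by apply/eqP => yE; have := ellJ_half_gt0; rewrite -yE J0 ltxx.
have : 2^-1 < y by rewrite lt_neqAle eq_sym y_neq.
by lra.
Qed.

End modulus.

(** * The energy of drops: lower bound and optimal curve *)

Section drop_energy.
Context {R : realType}.
Implicit Types (p z a d f g u v : R -> R) (x y t : R).
Notation mu := (@lebesgue_measure R).

Lemma segint_ae f g : segintegrable f 0 1 -> segintegrable g 0 1 ->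
  {ae mu, forall x, x \in `]0, 1[ -> f x = g x} ->
  segint f 0 1 = segint g 0 1.
Proof.
move=> fi gi fg; rewrite !segint_oo//; congr fine.
have sub : `]0, 1[ `<=` (`[0, 1] : set R) by exact: subset_itv_oo_cc.
apply: ae_eq_integral => //.
- by apply: (measurable_int mu); apply: integrableS fi.
- by apply: (measurable_int mu); apply: integrableS gi.
- apply: filterS fg; first exact: (ae_filter_ringOfSetsType mu).
  by move=> x fgx x01; rewrite fgx.
Qed.

Lemma L2_mul_segintegrable a d : L2 a -> L2 d -> segintegrable (fun x => a x * d x) 0 1.
Proof.
move=> aL dL; have := Lfun2_mul_Lfun1 aL dL; rewrite Lfun1_integrable => i1.
apply: (@eq_integrable _ _ _ mu _ _ (EFin \o ((a \_ `[0, 1]) \* (d \_ `[0, 1])))) => //.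
  by move=> x /[!inE] x01 /=; rewrite !patchE mem_set.
exact: integrableS i1.
Qed.

(** For velocity [(p, z)], acceleration [(a, d)] and speed [v], the inner quotient is the angular
    velocity [w = k v], so this is [w^2 / v + v = (k^2 + 1) v]. *)
Definition energy_density p z a d x :=
  ((p x * d x - z x * a x) / (p x ^+ 2 + z x ^+ 2)) ^+ 2 /
    Num.sqrt (p x ^+ 2 + z x ^+ 2) + Num.sqrt (p x ^+ 2 + z x ^+ 2).

(** Expanding the square leaves products of two L^2 functions, with continuous coefficients such as
    [p^2 / v^5]. *)
Lemma energy_density_segintegrable p z a d : continuous p -> continuous z ->
  (forall x, 0 < p x ^+ 2 + z x ^+ 2) -> L2 a -> L2 d ->
  segintegrable (energy_density p z a d) 0 1.
Proof.
move=> cp cz v2_gt0 aL dL; pose v x := Num.sqrt (p x ^+ 2 + z x ^+ 2).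
have cX f n : continuous f -> continuous (fun x => f x ^+ n).
  move=> cf x; apply: (@continuous_comp _ _ _ f (fun r : R => r ^+ n)); first exact: cf.
  exact: exprn_continuous.
have v0 x : v x != 0 by rewrite gt_eqF// sqrtr_gt0.
have cv : continuous v.
  move=> x; apply: (@continuous_comp _ _ _ (fun x => p x ^+ 2 + z x ^+ 2)).
    by apply: cvgD; exact: cX.
  exact: sqrt_continuous.
have cV5 : continuous (fun x => (v x ^+ 5)^-1).
  by move=> x; apply: cvgV; [rewrite expf_neq0|exact: cX].
have cMV f g : continuous f -> continuous g ->
    {within `[0, 1], continuous (fun x => f x * g x / v x ^+ 5)}.
  move=> cf cg; apply: continuous_subspaceT => x.
  by apply: cvgM; [apply: cvgM; [exact: cf|exact: cg]|exact: cV5].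
have i1 := segintegrableM (cMV _ _ cp cp) (L2_mul_segintegrable dL dL).
have i2 := segintegrableM (cMV _ _ cp cz) (L2_mul_segintegrable aL dL).
have i3 := segintegrableM (cMV _ _ cz cz) (L2_mul_segintegrable aL aL).
have i4 : segintegrable v 0 1 by exact: segintegrable_cont.
apply: eq_segintegrable (segintegrableD (segintegrableD (segintegrableB i1
  (segintegrableZ 2 i2)) i3) i4).
move=> x _; rewrite /energy_density -/(v x).
have -> : p x ^+ 2 + z x ^+ 2 = v x ^+ 2 by rewrite sqr_sqrtr// ltW.
by have := v0 x; move: (v x) => e e0; field.
Qed.

Lemma elastic_energyE (gamma : R -> R * R) p z : continuous p -> continuous z ->
  (forall x, 0 < p x ^+ 2 + z x ^+ 2) ->
  (forall x, 0 <= x <= 1 -> derivative01 (fst \o gamma) x = p x) ->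
  (forall x, 0 <= x <= 1 -> derivative01 (snd \o gamma) x = z x) ->
  L2 (weak_derivative 2 (fst \o gamma)) -> L2 (weak_derivative 2 (snd \o gamma)) ->
  elastic_energy gamma = (segint (energy_density p z
    (weak_derivative 2 (fst \o gamma)) (weak_derivative 2 (snd \o gamma))) 0 1)%:E.
Proof.
move=> cp cz v2_gt0 dp dz aL dL.
have ie := energy_density_segintegrable cp cz v2_gt0 aL dL.
rewrite /segint /Rintegral fineK; last exact: integrable_fin_num.
apply: eq_integral => x; rewrite inE/= in_itv/= => x01; congr EFin.
rewrite /curvature /speed /energy_density dp// dz//.
set v := Num.sqrt _; have v0 : v != 0 by rewrite gt_eqF// sqrtr_gt0.
have -> : p x ^+ 2 + z x ^+ 2 = v ^+ 2 by rewrite sqr_sqrtr// ltW.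
by field.
Qed.

Lemma drop_energy_ge y (gamma : R -> R * R) : 1 / 2 < y < 1 -> ellJ y = 0 ->
  drop_curve gamma ->
  ((2 * (pi * Num.sqrt (2 * (2 * y - 1)) * ellK y))%:E <= elastic_energy gamma)%E.
Proof.
move=> y12 J0 [[cgamma sob1 sob2] reg closed_gamma].
have cfst : {within `[0, 1], continuous (fst \o gamma)}.
  by move=> x; apply: cvg_comp; [exact: cgamma|exact: cvg_fst].
have csnd : {within `[0, 1], continuous (snd \o gamma)}.
  by move=> x; apply: cvg_comp; [exact: cgamma|exact: cvg_snd].
have [aL [U [p [dU ap uU dp]]]] := sobolev2_repr cfst sob1.
have [dL [W [z [dW az uW dz]]]] := sobolev2_repr csnd sob2.
have cp := ac_continuous ap; have cz := ac_continuous az.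
set a := weak_derivative 2 _ in aL ap; set d := weak_derivative 2 _ in dL az.
(* [ac_polar] works on the whole line. Outside [0, 1] the velocity is constant, so it equals its
   value at an endpoint, where regularity applies. *)
have v2_gt0 x : 0 < p x ^+ 2 + z x ^+ 2.
  rewrite lt_neqAle addr_ge0 ?sqr_ge0// andbT eq_sym.
  have regt t : 0 <= t <= 1 -> p t ^+ 2 + z t ^+ 2 != 0.
    move=> t01; have := reg t; rewrite in_itv/= => /(_ t01); rewrite /speed dp// dz//.
    by apply: contraNneq => ->; rewrite sqrtr0.
  have [x0|x0] := leP x 0.
    by rewrite -(ac_patch_const ap x0 (or_introl (lexx _))) -(ac_patch_const az x0 (or_introl (lexx _))); apply: regt; rewrite lexx ler01.
  have [x1|x1] := leP x 1; first by apply: regt; rewrite x1 ltW.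
  by rewrite (ac_patch_const ap (ltW x1) (or_intror (lexx _))) (ac_patch_const az (ltW x1) (or_intror (lexx _))); apply: regt; rewrite lexx ler01.
rewrite (elastic_energyE cp cz v2_gt0 dp dz aL dL) lee_fin -/a -/d.
have [th [ath thcos thsin]] := ac_polar ap az v2_gt0.
pose v x := Num.sqrt (p x ^+ 2 + z x ^+ 2).
have v0 x : 0 < v x by rewrite sqrtr_gt0.
have cv : continuous v.
  move=> x; apply: (@continuous_comp _ _ _ (fun x => p x ^+ 2 + z x ^+ 2)).
    by apply: cvgD; rewrite expr2; apply: cvgM; [exact: cp|exact: cp|exact: cz|exact: cz].
  exact: sqrt_continuous.
have ip : segintegrable p 0 1 by exact: segintegrable_cont.
have iz : segintegrable z 0 1 by exact: segintegrable_cont.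
have u01 : 0 <= (0 : R) <= 1 by rewrite lexx ler01.
have u11 : 0 <= (1 : R) <= 1 by rewrite lexx ler01.
have p0 : segint p 0 1 = 0.
  rewrite -(ac_derive cp dU ler01).2 -(uU _ u01) -(uU _ u11) /=.
  by rewrite closed_gamma subrr.
have z0 : segint z 0 1 = 0.
  rewrite -(ac_derive cz dW ler01).2 -(uW _ u01) -(uW _ u11) /=.
  by rewrite closed_gamma subrr.
have cth := ac_continuous ath.
(* Up to the factor [v 0], both [v cos th] and [v sin th] are fixed combinations of [p] and [z],
   whose integrals vanish because the curve is closed. *)
have zero f k l : continuous f -> (forall x, 0 <= x <= 1 -> v 0 * v x * f (th x) = k * p x + l * z x) ->
    segint (fun x => v x * f (th x)) 0 1 = 0.
  move=> cf fE; apply/eqP; rewrite -(mulrI_eq0 _ (mulfI (lt0r_neq0 (v0 0)))).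
  rewrite -segintZ; last first.
    apply: segintegrable_cont => x; apply: cvgM; first exact: cv.
    apply: (@continuous_comp _ _ _ th f); last exact: cf.
    exact: cth.
  rewrite (eq_segint (g := fun x => k * p x + l * z x)); last by move=> x /fE <-; rewrite mulrA.
  rewrite segintD; [|exact: segintegrableZ..].
  by rewrite !segintZ// p0 z0 !mulr0 addr0.
have vcos : segint (fun x => v x * cos (th x)) 0 1 = 0.
  apply: (zero _ (p 0) (z 0)); first exact: continuous_cos.
  by move=> x /andP[x0 _]; exact: thcos.
have vsin : segint (fun x => v x * sin (th x)) 0 1 = 0.
  apply: (zero _ (- z 0) (p 0)); first exact: continuous_sin.
  by move=> x /andP[x0 _]; rewrite thsin//; ring.
have densE x : 0 <= x <= 1 -> energy_density p z a d x =
    ((p x * (d \_ `[0, 1]) x - z x * (a \_ `[0, 1]) x) / (p x ^+ 2 + z x ^+ 2)) ^+ 2 / v x + v x.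
  by move=> x01; rewrite !patchE mem_set//= in_itv.
rewrite (eq_segint densE); apply: angle_energy_ge ath cv v0 _ vcos vsin => //.
exact: eq_segintegrable densE (energy_density_segintegrable cp cz v2_gt0 aL dL).
Qed.

(** The equality case [x = y]: the angle [-2 asin (k cos (pi t))] has cosine [1 - 2 y C^2] and sine
    [- 2 k C D], and equality in AM-GM forces the speed [c / D] with [c = pi sqrt (2 (2 y - 1))].
    The velocity [(p, z)] is read off from these. *)
Lemma optimal_drop y : 1 / 2 < y < 1 -> ellJ y = 0 ->
  exists2 gamma : R -> R * R, drop_curve gamma &
    elastic_energy gamma = (2 * (pi * Num.sqrt (2 * (2 * y - 1)) * ellK y))%:E.
Proof.
move=> y12 J0; have y01 : 0 <= y < 1 by lra.
have pi0 := @pi_gt0 R.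
pose C t : R := cos (pi * t); pose S t : R := sin (pi * t); pose D := delta y.
have [k k2] : exists k : R, k ^+ 2 = y by exists (Num.sqrt y); rewrite sqr_sqrtr//; lra.
have s2 : Num.sqrt (2 * (2 * y - 1)) ^+ 2 = 2 * (2 * y - 1) by rewrite sqr_sqrtr//; lra.
have s0 : 0 < Num.sqrt (2 * (2 * y - 1)) by rewrite sqrtr_gt0; lra.
move: (Num.sqrt _) s2 s0 => s s2 s0.
have [c c0 cE] : exists2 c : R, 0 < c & c = pi * s by exists (pi * s) => //; rewrite mulr_gt0.
have D0 t : 0 < D t by exact: delta_gt0.
have Dn t : D t != 0 by rewrite gt_eqF.
have D2 t : D t ^+ 2 = 1 - y * C t ^+ 2 by exact: delta_sqr.
pose p t := c * ((1 - 2 * y * C t ^+ 2) / D t).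
pose z t := - (2 * k * c) * C t.
pose W t := - (2 * k * c / pi) * S t.
pose a t := c * y * pi * C t * S t * (4 / D t - (1 - 2 * y * C t ^+ 2) / D t ^+ 3).
pose d t := 2 * k * c * pi * S t.
have dW t : is_derive t 1 W (z t).
  have := is_derive_scale (- (2 * k * c / pi)) (is_derive_sinpi t).
  move=> /is_derive_eq; apply; rewrite /z -/(C t).
  by have := lt0r_neq0 pi0; move: (C t) (@pi R) => e P P0; field.
have dz t : is_derive t 1 z (d t).
  have := is_derive_scale (- (2 * k * c)) (is_derive_cospi t).
  by move=> /is_derive_eq; apply; rewrite /d -/(S t); ring.
have dp t : is_derive t 1 p (a t).
  have dC2 := is_derive_mul (is_derive_cospi t) (is_derive_cospi t).
  have d1 := is_derive_sub (is_derive_cst (1 : R) t 1) (is_derive_scale (2 * y) dC2).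
  have := is_derive_scale c (is_derive_mul d1 (is_derive_inv (Dn t) (is_derive_delta t y01))).
  rewrite (_ : (fun t => _) = p); last by apply/funext => r; rewrite /p expr2.
  move=> /is_derive_eq; apply; rewrite /a -/(C t) -/(S t) -/(D t) -expr2 /=.
  by have := Dn t; move: (C t) (S t) (D t) (@pi R) => e f g P g0; field.
have cS := @continuous_sinpi R; have cC := @continuous_cospi R.
have cD : continuous D by exact: continuous_delta.
have cDV : continuous (fun t => (D t)^-1).
  by move=> t; apply: cvgV; [exact: Dn|exact: cD].
have cd : continuous d by move=> t; apply: cvgM; [exact: cvg_cst|exact: cS].
have ca : continuous a.
  have cC2 : continuous (fun t => 1 - 2 * y * C t ^+ 2).
    move=> t; apply: cvgB; first exact: cvg_cst.
    apply: cvgM; first exact: cvg_cst.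
    by rewrite expr2; apply: cvgM; exact: cC.
  have cDV3 : continuous (fun t => (D t ^+ 3)^-1).
    move=> t; apply: cvgV; first by rewrite expf_neq0.
    apply: (@continuous_comp _ _ _ D (fun r : R => r ^+ 3)); first exact: cD.
    exact: exprn_continuous.
  move=> t; apply: cvgM.
    apply: cvgM; last exact: cS.
    by apply: cvgM; [exact: cvg_cst|exact: cC].
  apply: cvgB; first by apply: cvgM; [exact: cvg_cst|exact: cDV].
  by apply: cvgM; [exact: cC2|exact: cDV3].
have cp := continuous_derive dp; have cz := continuous_derive dz.
have [U dU] := primitive_exists cp.
have cU := continuous_derive dU; have cW := continuous_derive dW.
have v2E t : p t ^+ 2 + z t ^+ 2 = (c / D t) ^+ 2.
  have -> : p t ^+ 2 + z t ^+ 2 =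
      c ^+ 2 / D t ^+ 2 * ((1 - 2 * y * C t ^+ 2) ^+ 2 + 4 * k ^+ 2 * C t ^+ 2 * D t ^+ 2).
    by rewrite /p /z; have := Dn t; move: (C t) (D t) => e g g0; field.
  rewrite k2 expr_div_n -[RHS]mulr1; congr (_ * _); rewrite D2; ring.
have v2_gt0 t : 0 < p t ^+ 2 + z t ^+ 2 by rewrite v2E exprn_gt0// divr_gt0.
have vE t : Num.sqrt (p t ^+ 2 + z t ^+ 2) = c / D t.
  by rewrite v2E sqrtr_sqr gtr0_norm// divr_gt0.
pose gamma t : R * R := (U t, W t).
have d1 t : 0 <= t <= 1 -> derivative01 (fst \o gamma) t = p t.
  by move=> t01; apply: (@derivative01_eq _ _ U).
have d2 t : 0 <= t <= 1 -> derivative01 (snd \o gamma) t = z t.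
  by move=> t01; apply: (@derivative01_eq _ _ W).
have sob1 : sobolev 2 (fst \o gamma) := C2_sobolev dU dp ca.
have sob2 : sobolev 2 (snd \o gamma) := C2_sobolev dW dz cd.
exists gamma.
  split.
  - split=> //; apply: continuous_subspaceT => t.
    exact: cvg_pair (cU t) (cW t).
  - move=> t; rewrite in_itv/= => t01; rewrite /speed d1// d2// gt_eqF//.
    by rewrite sqrtr_gt0.
  (* The second coordinate closes because the sine vanishes at 0 and [pi]; the increment of the
     first is [c * ellJ y], so the choice of [y] closes it. *)
  - congr pair; last by rewrite /W /S mulr0 mulr1 sin0 sinpi.
    apply/esym/eqP; rewrite -subr_eq0 (ac_derive cp dU ler01).2 /p.
    rewrite segintZ -/(ellJ y) ?J0 ?mulr0//.
    apply: eq_segintegrable (segintegrableZ c^-1 (segintegrable_cont 0 1 cp)).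
    by move=> t _; rewrite /p mulKf// gt_eqF.
have [aL _] := sobolev2_repr (continuous_subspaceT cU) sob1.
have [dL _] := sobolev2_repr (continuous_subspaceT cW) sob2.
rewrite (elastic_energyE cp cz v2_gt0 d1 d2 aL dL); congr EFin.
have L2c f : continuous f -> L2 f by move=> cf; apply: continuous_L2; exact: continuous_subspaceT.
rewrite (@segint_ae _ (energy_density p z a d)); last 3 first.
- exact: energy_density_segintegrable.
- by apply: energy_density_segintegrable => //; exact: L2c.
- have ae1 := weak_derivative2_ae dU dp ca; have ae2 := weak_derivative2_ae dW dz cd.
  have FF := ae_filter_ringOfSetsType mu.
  apply: filterS2 ae1 ae2 => t ae1 ae2 t01.
  by rewrite /energy_density (ae1 t01 : weak_derivative 2 (fst \o gamma) t = _)
    (ae2 t01 : weak_derivative 2 (snd \o gamma) t = _).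
have iK : segintegrable (fun t => (D t)^-1) 0 1 by exact: segintegrable_cont.
have iQ : segintegrable (fun t => y * S t ^+ 2 / D t) 0 1.
  apply: segintegrable_cont => t; apply: cvgM; last exact: cDV.
  apply: cvgM; first exact: cvg_cst.
  by rewrite expr2; apply: cvgM; exact: cS.
(* The bending and length terms. Their integrals turn out equal, as equality in AM-GM requires once
   the multiplier term integrates to zero. *)
rewrite (eq_segint (g := fun t => 4 * pi ^+ 2 / c * (y * S t ^+ 2 / D t) + c * (D t)^-1)); last first.
  move=> t _; rewrite /energy_density vE v2E.
  have -> : p t * d t - z t * a t = 2 * k * c ^+ 2 * pi * S t / D t ^+ 3.
    transitivity (2 * k * c ^+ 2 * pi * S t / D t ^+ 3 *
      ((1 - 2 * y * C t ^+ 2) * D t ^+ 2 + 4 * y * C t ^+ 2 * D t ^+ 2 -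
        (1 - 2 * y * C t ^+ 2) * (y * C t ^+ 2))).
      rewrite /p /z /a /d; have := Dn t.
      by move: (C t) (S t) (D t) (@pi R) => e f g P g0; field.
    by rewrite D2 -[RHS]mulr1; congr (_ * _); ring.
  rewrite -k2; have := Dn t; have := lt0r_neq0 c0.
  by move: (S t) (D t) (@pi R) => f g P cn0 g0; field; rewrite cn0 g0.
rewrite segintD; [|exact: segintegrableZ..].
rewrite !segintZ// segint_sin2_delta// -/(ellK y).
have -> : 2 * y - 1 = s ^+ 2 / 2 by rewrite s2; field.
rewrite cE; have := lt0r_neq0 s0; have := lt0r_neq0 pi0.
by move: (ellK y) (@pi R) => K P P0 s0'; field; rewrite s0' P0.
Qed.

End drop_energy.

Theorem theorem4p4 (R : realType) :
  exists gamma : R -> R * R,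
    drop_curve gamma /\
    elastic_energy gamma = ereal_inf [set elastic_energy g | g in @drop_curve R].
Proof.
have [y y12 J0] := @ellJ_root R.
have [gamma gammaD gammaE] := optimal_drop y12 J0.
exists gamma; split=> //; apply/eqP; rewrite eq_le; apply/andP; split.
  by apply: le_ereal_inf_tmp => _ [g gD <-]; rewrite gammaE; exact: drop_energy_ge.
by apply: ge_ereal_inf; exists (elastic_energy gamma) => //; exists gamma.
Qed.
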